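(* Let $T\in(0,\infty]$, let $\phi:[0,T)\to(0,\infty)$ be continuously differentiable with $\phi(0)=1$, let $\psi,\sigma:[0,T)\to\mathbb{R}$ be continuous, and suppose that there is some $\delta\in(0,T]$ with $\sigma(t)\neq 0$ for all $t\in(0,\delta)$. Let $(B_t)_{t\ge 0}$ be a standard Wiener process on a probability space $(\Omega,\mathcal{A},\mathbb{P})$, let $\xi\in\mathbb{R}$ be non-random, let $(Z_t)_{t\in[0,T)}$ be the pathwise unique strong solution of $$\mathrm{d}Z_t=\left(\frac{\phi'(t)}{\phi(t)}Z_t+\psi(t)\right)\mathrm{d}t+\sigma(t)\,\mathrm{d}B_t,\qquad t\in[0,T),\qquad Z_0=\xi,$$ and let $\widetilde Z_t:=Z_t-\mathbb{E}(Z_t)$, $t\in[0,T)$. If $\lim_{t\uparrow T}\phi(t)=0$ and there exists some $\varepsilon>0$ such that the function $$[0,T)\ni t\mapsto \phi(t)\left(\int_0^t\frac{\sigma(u)^2}{\phi(u)^2}\,\mathrm{d}u\right)^{\frac12+\varepsilon}$$ is bounded, then $\mathbb{P}\big(\lim_{t\uparrow T}\widetilde Z_t=0\big)=1$.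
   Context: The solution of the SDE is given explicitly by $Z_t=\phi(t)\left(\xi+\int_0^t\frac{\psi(u)}{\phi(u)}\,\mathrm{d}u+\int_0^t\frac{\sigma(u)}{\phi(u)}\,\mathrm{d}B_u\right)$, $t\in[0,T)$, so that $\widetilde Z_t=\phi(t)\int_0^t\frac{\sigma(u)}{\phi(u)}\,\mathrm{d}B_u$. *)

(* Defs.v *)
From HB Require Import structures.
From mathcomp Require Import all_boot all_order all_algebra.
From mathcomp Require Import all_classical all_reals all_analysis.

Set Implicit Arguments.
Unset Strict Implicit.
Unset Printing Implicit Defensive.
Import Order.TTheory GRing.Theory Num.Theory.
Import numFieldNormedType.Exports.
Local Open Scope classical_set_scope.
Local Open Scope ring_scope.

(* [0, T[ with T possibly +oo *)
Definition horizon (R : realType) (T : \bar R) : set R :=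
  [set t | 0 <= t /\ (t%:E < T)%E].

(* The filter "t tends to T from the left", with T possibly +oo. *)
Definition left_nbhs (R : realType) (T : \bar R) : set_system R :=
  match T with
  | r%:E => r^'-
  | +oo%E => +oo_R
  | -oo%E => -oo_R
  end.

Global Instance left_nbhs_proper (R : realType) (T : \bar R) :
  ProperFilter (left_nbhs T).
Proof. by case: T => [r| |] /=; exact: _. Qed.

(* [f' x] is the derivative of [f] at [x] relative to [D]; on [D = [0, T[] this
   is the right derivative at [0] and the usual derivative elsewhere. *)
Definition is_C1_on (R : realType) (D : set R) (f f' : R -> R) : Prop :=
  (forall x, D x ->
    (f y - f x) / (y - x) @[y --> within D x^'] --> f' x) /\
  {within D, continuous f'}.

(* The product rule for subfamilies follows by taking [A i = setT]. *)
Definition mutually_independent (d : measure_display) (Omega : measurableType d)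
    (R : realType) (P : probability Omega R) (n : nat)
    (X : 'I_n -> Omega -> R) : Prop :=
  forall A : 'I_n -> set R, (forall i, measurable (A i)) ->
    P [set w | forall i, A i (X i w)] =
    (\prod_(i < n) P (X i @^-1` A i))%E.

(* Standard Wiener process; only the times [0 <= t] are constrained.
   [normal_prob] takes the standard deviation. *)
Record is_wiener (d : measure_display) (Omega : measurableType d)
    (R : realType) (P : probability Omega R) (B : R -> {RV P >-> R}) : Prop :=
  IsWiener {
    wiener_start : {ae P, forall w, B 0 w = 0} ;
    wiener_indep : forall (n : nat) (t : nat -> R),
      0 <= t 0%N -> (forall i, t i <= t i.+1) ->
      mutually_independent P
        (fun (i : 'I_n) (w : Omega) => B (t i.+1) w - B (t i) w) ;
    wiener_gauss : forall s t : R, 0 <= s -> s < t ->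
      forall A : set R, measurable A ->
      P ((fun w => B t w - B s w) @^-1` A) = normal_prob 0 (Num.sqrt (t - s)) A ;
    wiener_cont : {ae P, forall w,
      {within [set t : R | 0 <= t], continuous (fun t => B t w)}}
  }.

(* Augmented natural filtration of [B]: generated by [B s], [0 <= s <= t],
   and the [P]-null events. *)
Definition wiener_filtration (d : measure_display) (Omega : measurableType d)
    (R : realType) (P : probability Omega R) (B : R -> {RV P >-> R}) (t : R) :
    set (set Omega) :=
  <<s [set E | (exists (s : R) (A : set R),
                  [/\ 0 <= s, s <= t, measurable A & E = B s @^-1` A]) \/
               (measurable E /\ P E = 0%E)] >>.

(* A list of triples ((a, b), c) encodes the step function
   \sum c 1_]a, b]; the intervals are allowed to overlap. *)
Definition step_fun (R : realType) (h : seq (R * R * R)) (u : R) : R :=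
  \sum_(i <- h) i.2 * \1_(`]i.1.1, i.1.2]%classic) u.

Definition step_on (R : realType) (t : R) (h : seq (R * R * R)) : Prop :=
  forall i, i \in h -> [/\ 0 <= i.1.1, i.1.1 <= i.1.2 & i.1.2 <= t].

Definition step_integral (R : realType) (Omega : Type) (B : R -> Omega -> R)
    (h : seq (R * R * R)) (w : Omega) : R :=
  \sum_(i <- h) i.2 * (B i.1.2 w - B i.1.1 w).

(* [J] is the Ito integral process of the deterministic integrand [f]:
   a process with a.s. continuous paths on [0, T[ such that [J t] is the limit
   in L^2(P) of integrals of step functions tending to [f] in L^2([0, t]). *)
Record is_ito_integral (d : measure_display) (Omega : measurableType d)
    (R : realType) (P : probability Omega R) (B : R -> {RV P >-> R})
    (T : \bar R) (f : R -> R) (J : R -> Omega -> R) : Prop :=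
  IsItoIntegral {
    ito_measurable : forall t, horizon T t -> measurable_fun setT (J t) ;
    ito_cont : {ae P, forall w,
      {within horizon T, continuous (fun t => J t w)}} ;
    ito_L2 : forall t, horizon T t ->
      exists h : nat -> seq (R * R * R),
        [/\ forall n, step_on t (h n),
            (\int[lebesgue_measure]_(u in `[0%R, t])
               ((step_fun (h n) u - f u) ^+ 2)%:E)%E @[n --> \oo] --> 0%E &
            'E_P[fun w => ((step_integral B (h n) w - J t w) ^+ 2)%R]%E
               @[n --> \oo] --> 0%E]
  }.

(* Strong solution on [0, T[ of
     dZ_t = (a t * Z_t + b t) dt + sigma t dB_t,  Z_0 = xi,
   with deterministic coefficients and initial value. *)
Record is_strong_solution (d : measure_display) (Omega : measurableType d)
    (R : realType) (P : probability Omega R) (B : R -> {RV P >-> R})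
    (T : \bar R) (a b sigma : R -> R) (xi : R) (Z : R -> Omega -> R) : Prop :=
  IsStrongSolution {
    solution_measurable : forall t, horizon T t -> measurable_fun setT (Z t) ;
    solution_adapted : forall t, horizon T t ->
      forall A : set R, measurable A -> wiener_filtration B t (Z t @^-1` A) ;
    solution_cont : {ae P, forall w,
      {within horizon T, continuous (fun t => Z t w)}} ;
    solution_eq : exists2 J : R -> Omega -> R,
      is_ito_integral B T sigma J &
      {ae P, forall w, forall t, horizon T t ->
        Z t w = xi + \int[lebesgue_measure]_(s in `[0, t])
                       (a s * Z s w + b s)
                   + J t w}
  }.

(* Main.v *)
Require Import Defs.
From mathcomp Require Import all_boot all_order all_algebra.
From mathcomp Require Import all_classical all_reals all_analysis.
From mathcomp Require Import measurable_realfun ring lra.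
Import Order.TTheory GRing.Theory Num.Theory.
Import numFieldNormedType.Exports.
Set Implicit Arguments.
Unset Strict Implicit.
Unset Printing Implicit Defensive.
Local Open Scope classical_set_scope.
Local Open Scope ring_scope.

(** Let f = sigma / phi, A(t) = \int_0^t f^2 and
    M_t = Z_t / phi(t) - xi - \int_0^t psi / phi ([normalized_solution]).
    Variation of constants says that M is the Wiener integral of f.  Hence
    E M_t = 0, so that Z_t - E Z_t = phi(t) M_t, and what has to be shown is that
    M grows more slowly than 1 / phi.

    The growth of M is controlled by its variance A.  A maximal inequality bounds
    the probability that |M| exceeds 3 r before A exceeds K by a constant times
    K / r^2 ([tail_event_bound]).  With K = 2^n, r = 2^(n p) and
    p = 1/2 + eps/2 these bounds are summable, so by Borel-Cantelli almost surely
    |M_t| <= 3 (2^n0 + 2 A(t))^p for all t and some random n0.  The assumption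
    bounds phi A^q with q = 1/2 + eps > p, and interpolating,
    phi A^p = phi^(1 - p/q) (phi A^q)^(p/q), which tends to 0 with phi
    ([power_envelope_decay]).

    The predicate [wiener_integral B u f X] says that the pair (f, X) is a limit,
    in L^2([0, u]) and in L^2(P) at once, of pairs formed by a step function and
    its integral.  Such pairs form a vector space.  The isometry for step functions
    ([step_integral_isometry]) bounds E X^2 by the integral of f^2, and with Fatou's
    lemma it closes the space under L^2 convergence of the integrands combined with
    almost sure convergence of the variables ([wiener_integral_lim]).  This is how M
    is identified: if J is the Ito integral of sigma, the sums of
    (J_{t_(i+1)} - J_{t_i}) / phi(t_i) over a uniform grid are integrals of functions
    that tend to f in L^2, and along each path the equation for Z turns them into
    Riemann sums that converge to M ([pathwise_sum_cvg],
    [normalized_solution_wiener_integral]).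

    The maximal inequality starts from Ottaviani's inequality for sums of
    independent variables ([ottaviani]), applied to the integral of a grid
    approximation of f.  Chebyshev's inequality transfers it to M at finitely many
    times ([wiener_integral_maximal]), continuity from below to all rational times,
    and continuity of the paths to all times ([sup_bound_outside_tail]). *)

(** * Second moments of step integrals *)

Section increments.
Context d (T : measurableType d) (R : realType) (mu : {measure set T -> \bar R}).
Variables (D : set T) (mD : measurable D).

Lemma integral_lincomb (I : eqType) (s : seq I) (k v : I -> R) (F : I -> T -> R) :
  (forall i, i \in s -> mu.-integrable D (EFin \o F i) /\
     (\int[mu]_(x in D) (F i x)%:E = (v i)%:E)%E) ->
  mu.-integrable D (EFin \o (fun x => \sum_(i <- s) k i * F i x)) /\
  (\int[mu]_(x in D) (\sum_(i <- s) k i * F i x)%:E =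
    (\sum_(i <- s) k i * v i)%:E)%E.
Proof.
elim: s => [|i s IH] Fs.
  split.
    apply: (eq_integrable mD (cst 0%E)) => //; last exact: integrable0.
    by move=> x _ /=; rewrite big_nil.
  under eq_integral do rewrite big_nil.
  by rewrite big_nil integral0.
have [intF eF] := Fs i (mem_head _ _).
have [|intS eS] := IH; first by move=> j js; apply: Fs; rewrite inE js orbT.
have intkF : mu.-integrable D (fun x => ((k i)%:E * (F i x)%:E)%E).
  exact: integrableZl.
split.
  apply: (eq_integrable mD (fun x => (k i)%:E * (F i x)%:E +
    (\sum_(j <- s) k j * F j x)%:E)%E).
    by move=> x _ /=; rewrite big_cons EFinD EFinM.
  exact: integrableD.
under eq_integral do rewrite big_cons EFinD EFinM.
rewrite integralD// integralZl// eF [X in (_ + X)%E]eS.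
by rewrite -EFinM -EFinD big_cons.
Qed.

(** Polarization writes (b - a)(d - c) in terms of the squares of b - c, a - d,
    b - d and a - c; the summand is what the product of two weighted increments
    integrates to when the increment from s to t has second moment |t - s|. *)
Definition step_energy (h : seq (R * R * R)) : R :=
  \sum_(p <- [seq (i, j) | i <- h, j <- h])
    p.1.2 * p.2.2 / 2 * (`|p.1.1.2 - p.2.1.1| + `|p.1.1.1 - p.2.1.2|
      - `|p.1.1.2 - p.2.1.2| - `|p.1.1.1 - p.2.1.1|).

(** The second moments of the increments of X determine those of all step integrals,
    by polarization.  Both sides of the isometry are instances: a Wiener process,
    and the family of the indicators of ]-oo, t] over Lebesgue measure. *)
Lemma integral_step_integral_sqr (X : R -> T -> R) (c u : R) (h : seq (R * R * R)) :
  (forall t, measurable_fun D (X t)) ->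
  (forall s t, 0 <= s <= u -> 0 <= t <= u ->
    (\int[mu]_(x in D) ((X t x - X s x) ^+ 2)%:E = (c * `|t - s|)%:E)%E) ->
  step_on u h ->
  (\int[mu]_(x in D) ((step_integral X h x) ^+ 2)%:E = (c * step_energy h)%:E)%E.
Proof.
move=> mX hX hu.
have hXi s t : 0 <= s <= u -> 0 <= t <= u ->
    mu.-integrable D (EFin \o (fun x => (X t x - X s x) ^+ 2)).
  move=> su tu; apply/integrableP; split.
    by apply/measurable_EFinP/measurable_funX/measurable_funB.
  under eq_integral do rewrite /= ger0_norm ?sqr_ge0//.
  by rewrite hX// ltry.
have in1 i : i \in h -> 0 <= i.1.1 <= u /\ 0 <= i.1.2 <= u.
  move=> /hu[a0 ab bu]; rewrite a0 bu (le_trans ab bu) (le_trans a0 ab); split=> //.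
pose V (q : R * R) := (c * `|q.1 - q.2|).
pose F (p : (R * R * R) * (R * R * R)) x :=
  ((X p.1.1.2 x - X p.2.1.1 x) ^+ 2 + (X p.1.1.1 x - X p.2.1.2 x) ^+ 2
      - (X p.1.1.2 x - X p.2.1.2 x) ^+ 2 - (X p.1.1.1 x - X p.2.1.1 x) ^+ 2).
pose v (p : (R * R * R) * (R * R * R)) :=
  c * (`|p.1.1.2 - p.2.1.1| + `|p.1.1.1 - p.2.1.2|
      - `|p.1.1.2 - p.2.1.2| - `|p.1.1.1 - p.2.1.1|).
have := @integral_lincomb _ [seq (i, j) | i <- h, j <- h]
  (fun p => p.1.2 * p.2.2 / 2) v F.
case.
  move=> p /allpairsP[[i j]/= [ih jh ->]] /=.
  have [ia ib] := in1 i ih; have [ja jb] := in1 j jh.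
  have /= := @integral_lincomb _ [:: (i.1.2, j.1.1, 1); (i.1.1, j.1.2, 1);
    (i.1.2, j.1.2, -1); (i.1.1, j.1.1, -1)] (fun q => q.2)
    (fun q => c * `|q.1.1 - q.1.2|) (fun q x => (X q.1.1 x - X q.1.2 x) ^+ 2).
  case.
    by move=> q; rewrite !inE => /or4P[] /eqP-> /=; split; [exact: hXi|exact: hX
      |exact: hXi|exact: hX|exact: hXi|exact: hX|exact: hXi|exact: hX].
  have eF x : \sum_(q <- [:: (i.1.2, j.1.1, 1); (i.1.1, j.1.2, 1);
    (i.1.2, j.1.2, -1); (i.1.1, j.1.1, -1)]) q.2 * (X q.1.1 x - X q.1.2 x) ^+ 2 = F (i, j) x.
    by rewrite !big_cons big_nil /F/=; ring.
  under eq_fun do rewrite eF.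
  under eq_integral do rewrite eF.
  move=> intF ->; split=> //.
  by rewrite !big_cons big_nil /v/=; congr EFin; ring.
move=> _ eI.
transitivity (\int[mu]_(x in D) (\sum_(p <- [seq (i, j) | i <- h, j <- h])
  (fun p => p.1.2 * p.2.2 / 2) p * F p x)%:E)%E.
  apply: eq_integral => x _; congr EFin.
  rewrite big_allpairs expr2 /step_integral big_distrl/=.
  apply: eq_bigr => i _; rewrite big_distrr/=; apply: eq_bigr => j _.
  by rewrite /F/=; field.
rewrite eI; congr EFin; rewrite /step_energy big_distrr/=.
by apply: eq_bigr => p _; rewrite /v; ring.
Qed.

End increments.

Section step_functions.
Context (R : realType).
Implicit Types (u : R) (h : seq (R * R * R)).
Notation leb := (@lebesgue_measure R).

Definition down_indic (b x : R) : R := \1_(`]-oo, b]%classic) x.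

Lemma step_funE u h x : step_on u h -> step_fun h x = step_integral down_indic h x.
Proof.
move=> hu; rewrite /step_fun /step_integral !big_seq; apply: eq_bigr => i /hu[_ ab _].
congr (_ * _); rewrite /down_indic !indicE.
rewrite !mem_setE !in_itv/=.
case: (leP x i.1.2) => xb; case: (leP x i.1.1) => xa //=; rewrite ?subrr ?subr0//.
by move: (lt_le_trans xb (le_trans xa ab)); rewrite ltxx.
Qed.

Lemma measurable_step_fun D h : measurable_fun D (step_fun h).
Proof.
apply: measurable_sum => i; apply: measurable_funM => //; exact: measurable_indic.
Qed.

(** A step function is the step integral of t |-> 1_]-oo, t], whose increment from
    s to t has square integral |t - s| over [0, u]. *)
Lemma step_fun_energy u h : step_on u h ->
  (\int[leb]_(x in `[0%R, u]) ((step_fun h x) ^+ 2)%:E = (step_energy h)%:E)%E.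
Proof.
move=> hu; under eq_integral do rewrite (step_funE _ hu).
rewrite -[step_energy h]mul1r.
have mu0 : measurable (`[0, u]%classic : set R) by [].
apply: (@integral_step_integral_sqr _ _ R leb `[0, u]%classic mu0 down_indic 1 u h) => //.
- by move=> t; exact: measurable_indic.
have sym : forall s t, 0 <= s <= u -> 0 <= t <= u -> s <= t ->
    (\int[leb]_(x in `[0%R, u]) ((down_indic t x - down_indic s x) ^+ 2)%:E =
     (`|t - s|)%:E)%E.
  move=> s t /andP[s0 su] /andP[t0 tu] st.
  transitivity (\int[leb]_(x in `[0%R, u]) (\1_(`]s, t]) x)%:E)%E.
    apply: eq_integral => x _; rewrite /down_indic !indicE !mem_setE !in_itv/=.
    case: (leP x t) => xb; case: (leP x s) => xa //=; rewrite ?subrr ?subr0 ?expr0n ?expr1n//.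
    by move: (lt_le_trans xb (le_trans xa st)); rewrite ltxx.
  rewrite integral_indic//= setIidl; last first.
    move=> x /=; rewrite !in_itv/= => /andP[sx xt].
    by rewrite (le_trans s0 (ltW sx)) (le_trans xt tu).
  rewrite lebesgue_measure_itv/= lte_fin; case: ltP => //= ts.
    by rewrite -EFinB ger0_norm// subr_ge0.
  by have -> : s = t by [apply/eqP; rewrite eq_le st]; rewrite subrr normr0.
move=> s t su tu; rewrite mul1r; case: (leP s t) => [|/ltW] st; first exact: sym.
rewrite distrC -sym//; apply: eq_integral => x _.
by rewrite -sqrrN opprB.
Qed.

End step_functions.

(** * Moments of Gaussian variables and of Wiener increments *)

Section normal_moments.
Context (R : realType).
Notation leb := (@lebesgue_measure R).

(** Uniqueness of the Radon-Nikodym derivative identifies it with the density. *)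
Lemma ge0_integral_normal_prob (s : R) (f : R -> \bar R) :
  (forall x, 0 <= f x)%E -> measurable_fun setT f ->
  (\int[normal_prob 0 s]_x f x = \int[leb]_x (f x * (normal_pdf 0 s x)%:E))%E.
Proof.
move=> f0 mf.
have dom := normal_prob_dominates 0 s.
rewrite -(Radon_Nikodym_SigmaFinite.change_of_variables dom)//.
have intg := Radon_Nikodym_SigmaFinite.f_integrable dom.
apply: ae_eq_integral => //.
- by apply: emeasurable_funM => //; exact: measurable_int intg.
- apply: emeasurable_funM => //; apply/measurable_EFinP; exact: measurable_normal_pdf.
- apply: ae_eqe_mul2l => /=.
  apply: integral_ae_eq => //=.
  + by apply/measurable_EFinP; exact: measurable_normal_pdf.
  + by move=> E _ mE; rewrite -Radon_Nikodym_SigmaFinite.f_integral.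
Qed.

Definition normal_second_moment : R :=
  fine (\int[leb]_x (x ^+ 2 * normal_pdf 0 1 x)%:E)%E.

Lemma normal_pdf_scale (s x : R) : 0 < s ->
  normal_pdf 0 s (s * x) * s = normal_pdf 0 1 x.
Proof.
move=> s0; rewrite !normal_pdfE ?oner_eq0 ?gt_eqF//.
have -> : normal_peak s = normal_peak 1 / s.
  rewrite /normal_peak -mulrnAr expr1n mul1r sqrtrM ?sqr_ge0// sqrtr_sqr.
  by rewrite gtr0_norm// invfM mulrC.
have -> : normal_fun 0 s (s * x) = normal_fun 0 1 x.
  rewrite /normal_fun !subr0 expr1n; congr expR.
  by field; rewrite gt_eqF.
by field; rewrite gt_eqF.
Qed.

(** Since x^2 <= 4 exp(x^2 / 4), the integrand is dominated by a multiple of the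
    normal density of variance 2. *)
Lemma normal_second_moment_lty :
  (\int[leb]_x (x ^+ 2 * normal_pdf 0 1 x)%:E < +oo)%E.
Proof.
pose s : R := Num.sqrt 2.
have s0 : 0 < s by rewrite sqrtr_gt0.
have := @integrable_normal_pdf R 0 s.
move=> /(integrableZl measurableT (4 * normal_peak 1 / normal_peak s)) intg.
have Ig : (\int[leb]_x ((4 * normal_peak 1 / normal_peak s)%:E * (normal_pdf 0 s x)%:E) < +oo)%E.
  have /integrableP[_] := intg.
  apply: le_lt_trans; apply: ge0_le_integral => //.
  - move=> x _; rewrite -EFinM lee_fin !mulr_ge0 ?invr_ge0 ?normal_peak_ge0 ?normal_pdf_ge0//.
  - exact: measurable_int intg.
  - by apply: measurableT_comp => //; exact: measurable_int intg.
  - by move=> x _; rewrite lee_abs.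
apply: le_lt_trans Ig; apply: ge0_le_integral => //.
- by move=> x _; rewrite lee_fin mulr_ge0 ?sqr_ge0 ?normal_pdf_ge0.
- apply/measurable_EFinP/measurable_funM => //; exact: measurable_normal_pdf.
- exact: measurable_int intg.
- move=> x _; rewrite -EFinM lee_fin.
rewrite !normal_pdfE ?oner_eq0 ?gt_eqF//.
have ps0 : normal_peak s != 0 by rewrite gt_eqF// normal_peak_gt0// gt_eqF.
have -> : 4 * normal_peak 1 / normal_peak s * (normal_peak s * normal_fun 0 s x) =
  normal_peak 1 * (4 * normal_fun 0 s x) by field.
rewrite mulrCA ler_wpM2l ?normal_peak_ge0//.
rewrite /normal_fun !subr0 expr1n /s sqr_sqrtr//.
have -> : - x ^+ 2 / (1 *+ 2) = - (x ^+ 2 / 4) + (- x ^+ 2 / (2 *+ 2)) :> R.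
  by field.
rewrite expRD mulrA ler_wpM2r ?expR_ge0// expRN ler_pdivrMr ?expR_gt0//.
by have := expR_ge1Dx (x ^+ 2 / 4); lra.
Qed.

Lemma normal_second_moment_scale (s : R) : 0 < s ->
  (\int[normal_prob 0 s]_x (x ^+ 2)%:E = (normal_second_moment * s ^+ 2)%:E)%E.
Proof.
move=> s0.
rewrite ge0_integral_normal_prob//; last 2 first.
- by move=> x; rewrite lee_fin sqr_ge0.
- exact/measurable_EFinP/measurable_funX.
pose F (y : R^o) : R^o := s * y.
have F'E : F^`()%classic = cst s.
  by apply/funext => x; rewrite /F derive1Ml// derive1_id mulr1.
have dF x : derivable F x 1 by apply: derivableM.
transitivity (\int[leb]_x (x ^+ 2 * normal_pdf 0 s x)%:E)%E.
  by apply: eq_integral => x _; rewrite EFinM.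
rewrite (@increasing_ge0_integration_by_substitutionT _ F (fun x => x ^+ 2 * normal_pdf 0 s x)).
- have c0 : (0 <= \int[leb]_x (x ^+ 2 * normal_pdf 0 1 x)%:E)%E.
    by apply: integral_ge0 => x _; rewrite lee_fin mulr_ge0 ?sqr_ge0 ?normal_pdf_ge0.
  rewrite EFinM /normal_second_moment fineK; last first.
    by rewrite ge0_fin_numE//; exact: normal_second_moment_lty.
  rewrite -ge0_integralZr//=; last 3 first.
  + by apply/measurable_EFinP/measurable_funM => //; exact: measurable_normal_pdf.
  + by move=> x _; rewrite lee_fin mulr_ge0 ?sqr_ge0 ?normal_pdf_ge0.
  + by rewrite lee_fin sqr_ge0.
  apply: eq_integral => x _; rewrite F'E -EFinM; congr EFin.
  rewrite -[LHS]/((s * x) ^+ 2 * normal_pdf 0 s (s * x) * s).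
  by rewrite -(normal_pdf_scale x s0); ring.
- by move=> a b ab; rewrite /F ltr_pM2l.
- by rewrite F'E => ?; exact: cvg_cst.
- by rewrite F'E; exact: is_cvg_cst.
- by rewrite F'E; exact: is_cvg_cst.
- exact: dF.
- by apply/gt0_cvgMrNy.
- by apply/gt0_cvgMry.
- move=> x; apply: cvgM; first exact: exprn_continuous.
  by apply: continuous_normal_pdf; rewrite gt_eqF.
- by move=> x; rewrite mulr_ge0 ?sqr_ge0 ?normal_pdf_ge0.
Qed.

Lemma normal_probN (s : R) (A : set R) : s != 0 -> measurable A ->
  normal_prob 0 s (-%R @^-1` A) = normal_prob 0 s A.
Proof.
move=> s0 mA; rewrite /normal_prob.
have mN : measurable_fun [set: measurableTypeR R] (-%R : measurableTypeR R -> measurableTypeR R).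
  exact: oppr_measurable.
transitivity (\int[leb]_(x in -%R @^-1` A) ((EFin \o normal_pdf 0 s) \o -%R) x)%E.
  apply: eq_integral => x _ /=; congr EFin.
  by rewrite !normal_pdfE// /normal_fun !subr0 sqrrN.
rewrite -(ge0_integral_pushforward mN)//=.
- by apply: eq_measure_integral => //= B mB _; exact: lebesgue_measureN.
- by apply/measurable_EFinP/measurable_funTS; exact: measurable_normal_pdf.
- by move=> x _; rewrite lee_fin normal_pdf_ge0.
Qed.

(** The law is symmetric, so the mean is its own opposite. *)
Lemma normal_mean0 (s : R) : 0 < s ->
  (normal_prob 0 s).-integrable setT (EFin : R -> \bar R) ->
  (\int[normal_prob 0 s]_x x%:E = 0)%E.
Proof.
move=> s0 intx.
have mN : measurable_fun [set: measurableTypeR R] (-%R : measurableTypeR R -> measurableTypeR R).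
  exact: oppr_measurable.
have eqN A : measurable A -> pushforward (normal_prob 0 s)
    (-%R : measurableTypeR R -> measurableTypeR R) A = normal_prob 0 s A.
  by move=> mA; rewrite -(normal_probN _ mA)// gt_eqF.
have intN : (normal_prob 0 s).-integrable setT (EFin \o -%R : R -> \bar R).
  have := integrableN intx.
  by apply: eq_integrable.
have : (\int[normal_prob 0 s]_x x%:E = - \int[normal_prob 0 s]_x x%:E)%E.
  rewrite -integralN//; last exact: integrable_add_def.
  transitivity (\int[pushforward (normal_prob 0 s)
    (-%R : measurableTypeR R -> measurableTypeR R)]_x x%:E)%E.
    by apply: eq_measure_integral => A mA _; exact/esym/eqN.
  by rewrite integral_pushforward//=; rewrite preimage_setT.
have : (\int[normal_prob 0 s]_x x%:E)%E \is a fin_num by exact: integrable_fin_num.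
case: (\int[normal_prob 0 s]_x x%:E)%E => // r _ [] rr; congr EFin; lra.
Qed.

End normal_moments.

(** The variable takes its values in [measurableTypeR R] because that is the
    measurable structure on which [normal_prob] is a measure. *)
Section gaussian_variables.
Context d (Omega : measurableType d) (R : realType) (P : probability Omega R).
Variables (X : Omega -> measurableTypeR R) (mX : measurable_fun setT X) (s : R).
Hypothesis s0 : 0 < s.
Hypothesis lawX : forall A, measurable A -> P (X @^-1` A) = normal_prob 0 s A.

Let X_mixin := isMeasurableFun.Build _ _ _ _ _ mX.
Let X_mfun : {mfun Omega >-> measurableTypeR R} := MeasurableFun.Pack (MeasurableFun.Class X_mixin).

Lemma gaussian_second_moment :
  (\int[P]_w (X w ^+ 2)%:E = (normal_second_moment R * s ^+ 2)%:E)%E.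
Proof.
transitivity (\int[distribution P X_mfun]_x (x ^+ 2)%:E)%E.
  rewrite (@ge0_integral_distribution _ _ _ _ _ _ X_mfun (fun x => (x ^+ 2)%:E))//.
  - exact/measurable_EFinP/measurable_funX.
  - by move=> x; rewrite lee_fin sqr_ge0.
rewrite -normal_second_moment_scale//.
by apply: eq_measure_integral => A mA _; exact: lawX.
Qed.

Lemma gaussian_mean0 : P.-integrable setT (fun w => (X w)%:E) ->
  (\int[P]_w (X w)%:E = 0)%E.
Proof.
move=> intX.
have mE : measurable_fun [set: measurableTypeR R] (EFin : R -> \bar R).
  by apply/measurable_EFinP.
transitivity (\int[distribution P X_mfun]_x x%:E)%E.
  by rewrite (@integral_distribution _ _ _ _ _ _ X_mfun EFin).
have intN : (normal_prob 0 s).-integrable setT (EFin : R -> \bar R).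
  have /integrableP[_ fi] : (distribution P X_mfun).-integrable setT (EFin : R -> \bar R).
    exact: (@integrable_pushforward _ _ _ _ _ X_mfun).
  apply/integrableP; split => //; apply: le_lt_trans fi.
  rewrite le_eqVlt; apply/orP; left; apply/eqP/esym.
  by apply: eq_measure_integral => A mA _; exact: lawX.
transitivity (\int[normal_prob 0 s]_x x%:E)%E.
  by apply: eq_measure_integral => A mA _; exact: lawX.
exact: normal_mean0.
Qed.

End gaussian_variables.

Section wiener_moments.
Context d (Omega : measurableType d) (R : realType) (P : probability Omega R).
Variables (B : R -> {RV P >-> R}) (B_wiener : is_wiener B).
Notation c := (normal_second_moment R).

Lemma normal_second_moment_ge0 : 0 <= c.
Proof.
apply: fine_ge0; apply: integral_ge0 => x _.
by rewrite lee_fin mulr_ge0 ?sqr_ge0 ?normal_pdf_ge0.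
Qed.

(** Scaling gives the factor |t - s|; the constant is the second moment of the
    standard normal law. *)
Lemma wiener_second_moment (s t : R) : 0 <= s -> 0 <= t ->
  (\int[P]_w ((B t w - B s w) ^+ 2)%:E = (c * `|t - s|)%:E)%E.
Proof.
wlog st : s t / s <= t => [hw s0 t0|s0 _].
  have [st|/ltW ts] := leP s t; first exact: hw.
  rewrite distrC -hw//; apply: eq_integral => w _.
  by rewrite -sqrrN opprB.
move: st; rewrite le_eqVlt => /predU1P[->|st].
  rewrite subrr normr0 mulr0; apply: integral0_eq => w _.
  by rewrite subrr expr0n.
rewrite (@gaussian_second_moment _ _ _ _ (fun w => B t w - B s w) _ (Num.sqrt (t - s))).
- by rewrite sqr_sqrtr ?subr_ge0 ?ltW// ger0_norm// subr_ge0 ltW.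
- exact: measurable_funB.
- by rewrite sqrtr_gt0 subr_gt0.
- by move=> A mA; exact: (wiener_gauss B_wiener).
Qed.

Lemma wiener_increment_integrable (s t : R) : 0 <= s -> 0 <= t ->
  P.-integrable setT (fun w => (B t w - B s w)%:E).
Proof.
move=> s0 t0; apply/integrableP; split.
  by apply/measurable_EFinP/measurable_funB.
apply: (@le_lt_trans _ _ (\int[P]_w (1%:E + ((B t w - B s w) ^+ 2)%:E))%E).
  apply: ge0_le_integral => //.
  - by apply/measurable_EFinP/measurableT_comp => //; exact: measurable_funB.
  - apply/measurable_EFinP/measurable_funD => //.
    by apply/measurable_funX/measurable_funB.
  - move=> w _; rewrite -EFinD lee_fin.
    have := sqr_ge0 (`|B t w - B s w| - 1); rewrite sqrrB1 real_normK ?num_real//.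
    have := normr_ge0 (B t w - B s w); lra.
rewrite ge0_integralD//; last 2 first.
- by move=> w _; rewrite lee_fin sqr_ge0.
- by apply/measurable_EFinP/measurable_funX/measurable_funB.
by rewrite wiener_second_moment// integral_cst//= mul1e probability_setT -EFinD ltry.
Qed.

Lemma wiener_mean0 (s t : R) : 0 <= s -> 0 <= t ->
  (\int[P]_w (B t w - B s w)%:E = 0)%E.
Proof.
wlog st : s t / s <= t => [hw s0 t0|s0 t0].
  have [st|/ltW ts] := leP s t; first exact: hw.
  transitivity (- \int[P]_w (B s w - B t w)%:E)%E; last by rewrite hw// oppe0.
  rewrite -integralN; last first.
    apply: integrable_add_def => //; exact: wiener_increment_integrable.
  by apply: eq_integral => w _; rewrite -EFinN opprB.
move: st; rewrite le_eqVlt => /predU1P[->|st].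
  by apply: integral0_eq => w _; rewrite subrr.
apply: (@gaussian_mean0 _ _ _ _ (fun w => B t w - B s w) _ (Num.sqrt (t - s))).
- exact: measurable_funB.
- by rewrite sqrtr_gt0 subr_gt0.
- by move=> A mA; exact: (wiener_gauss B_wiener).
- exact: wiener_increment_integrable.
Qed.

Lemma integrable_step_integral (u : R) h : step_on u h ->
  P.-integrable setT (EFin \o step_integral (fun t => B t) h) /\
  (\int[P]_w (step_integral (fun t => B t) h w)%:E = 0)%E.
Proof.
move=> hu.
have [] := @integral_lincomb _ _ _ P setT measurableT _ h (fun i => i.2) (fun=> 0)
  (fun i w => B i.1.2 w - B i.1.1 w).
  move=> i /hu[a0 ab _]; split.
    by apply: wiener_increment_integrable => //; exact: le_trans ab.
  by apply: wiener_mean0 => //; exact: le_trans ab.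
by move=> ? ->; split=> //; rewrite big1// => i _; rewrite mulr0.
Qed.

(** Both sides are multiples of [step_energy h]. *)
Lemma step_integral_isometry (u : R) h : step_on u h ->
  (\int[P]_w ((step_integral (fun t => B t) h w) ^+ 2)%:E =
   c%:E * \int[lebesgue_measure]_(x in `[0%R, u]) ((step_fun h x) ^+ 2)%:E)%E.
Proof.
move=> hu; rewrite (step_fun_energy hu) -EFinM.
apply: (@integral_step_integral_sqr _ _ _ P setT measurableT (fun t => B t) c u) => //.
by move=> s t /andP[s0 _] /andP[t0 _]; exact: wiener_second_moment.
Qed.

Lemma measurable_step_integral h :
  measurable_fun setT (step_integral (fun t => B t) h).
Proof.
by apply: measurable_sum => i; apply: measurable_funM => //; exact: measurable_funB.
Qed.

End wiener_moments.

(** * Integrals of squares *)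

Section square_integral.
Context d (T : measurableType d) (R : realType) (mu : {measure set T -> \bar R}).
Variables (D : set T) (mD : measurable D).
Implicit Types f g : T -> R.

(** The squared L^2 norm as an extended real, so that estimates can be chained
    without first proving integrability. *)
Definition sqint f : \bar R := (\int[mu]_(x in D) ((f x) ^+ 2)%:E)%E.

Lemma le_sqint f g : measurable_fun D f -> measurable_fun D g ->
  (forall x, D x -> `|f x| <= `|g x|) -> (sqint f <= sqint g)%E.
Proof.
move=> mf mg fg; apply: ge0_le_integral => //.
- by move=> x _; rewrite lee_fin sqr_ge0.
- exact/measurable_EFinP/measurable_funX.
- exact/measurable_EFinP/measurable_funX.
- move=> x Dx; rewrite lee_fin -[leLHS]real_normK ?num_real//.
  by rewrite -[leRHS]real_normK ?num_real// lerXn2r ?nnegrE// fg.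
Qed.

(** From (a x + y)^2 <= 2 a^2 x^2 + 2 y^2; a substitute for the triangle inequality
    that stays with squares. *)
Lemma sqint_lincomb (a : R) f g (v w : R) :
  measurable_fun D f -> measurable_fun D g ->
  (sqint f <= v%:E)%E -> (sqint g <= w%:E)%E ->
  (sqint (fun x => (a * f x + g x)%R) <= (2 * a ^+ 2 * v + 2 * w)%:E)%E.
Proof.
move=> mf mg fv gw.
have m2 (k : T -> R) : measurable_fun D k -> measurable_fun D (fun x => (k x ^+ 2)%:E).
  by move=> mk; exact/measurable_EFinP/measurable_funX.
apply: (@le_trans _ _ (\int[mu]_(x in D)
    ((2 * a ^+ 2)%:E * (f x ^+ 2)%:E + 2%:E * (g x ^+ 2)%:E))%E).
  apply: ge0_le_integral => //.
  - by move=> x _; rewrite lee_fin sqr_ge0.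
  - by apply: m2; apply: measurable_funD => //; exact: measurable_funM.
  - by apply: emeasurable_funD; apply: measurable_funeM; exact: m2.
  - move=> x _; rewrite -!EFinM -EFinD lee_fin.
    have := sqr_ge0 (a * f x - g x); lra.
have s0 (k : T -> R) x : D x -> (0 <= (k x ^+ 2)%:E)%E.
  by rewrite lee_fin sqr_ge0.
have a0 : (0 <= (2 * a ^+ 2)%:E)%E by rewrite lee_fin mulr_ge0// sqr_ge0.
rewrite ge0_integralD//; last 4 first.
- by move=> x Dx; rewrite mule_ge0// s0.
- by apply: measurable_funeM; exact: m2.
- by move=> x Dx; rewrite mule_ge0// s0.
- by apply: measurable_funeM; exact: m2.
rewrite !ge0_integralZl//; [|exact: m2|exact: s0|exact: m2|exact: s0].
by rewrite (EFinD (2 * a ^+ 2 * v)) (EFinM _ v) (EFinM 2 w) leeD// lee_wpmul2l.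
Qed.

Lemma eq_sqint f g : {in D, f =1 g} -> sqint f = sqint g.
Proof. by move=> fg; apply: eq_integral => x Dx; rewrite fg. Qed.

Lemma eq_sqint_le f g v : {in D, f =1 g} -> (sqint f <= v -> sqint g <= v)%E.
Proof. by move=> /eq_sqint ->. Qed.

Lemma sqintN f : sqint (fun x => - f x) = sqint f.
Proof. by apply: eq_integral => x _; rewrite sqrrN. Qed.

Lemma sqint_sub f g (k : T -> R) (v w : R) :
  measurable_fun D f -> measurable_fun D g -> measurable_fun D k ->
  (sqint (fun x => (f x - g x)%R) <= v%:E)%E -> (sqint (fun x => (g x - k x)%R) <= w%:E)%E ->
  (sqint (fun x => (f x - k x)%R) <= (2 * v + 2 * w)%:E)%E.
Proof.
move=> mf mg mk fg gk.
rewrite (@eq_sqint _ (fun x => 1 * (f x - g x) + (g x - k x))); last first.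
  by move=> x _ /=; ring.
have := @sqint_lincomb 1 _ _ v w (measurable_funB mf mg) (measurable_funB mg mk) fg gk.
by rewrite expr1n mulr1.
Qed.

Lemma sqint_fatou (X : nat -> T -> R) (Y : T -> R) (v : R) :
  (forall n, measurable_fun D (X n)) -> measurable_fun D Y ->
  {ae mu, forall x, D x -> X n x @[n --> \oo] --> Y x} ->
  (forall n, (sqint (X n) <= v%:E)%E) -> (sqint Y <= v%:E)%E.
Proof.
move=> mX mY XY Xv.
have m2 (k : T -> R) : measurable_fun D k -> measurable_fun D (fun x => (k x ^+ 2)%:E).
  by move=> mk; exact/measurable_EFinP/measurable_funX.
have -> : sqint Y = (\int[mu]_(x in D) limn_einf (fun n => (X n x ^+ 2)%:E))%E.
  apply: ae_eq_integral => //; first exact: m2.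
    rewrite (_ : (fun _ => _) = (fun x => - limn_esup (fun n => - (X n x ^+ 2)%:E)))%E.
      apply: measurableT_comp => //; apply: measurable_fun_limn_esup => n.
      by apply: measurableT_comp => //; exact: m2.
    by apply/funext => x; rewrite limn_esupN oppeK.
  apply: filterS XY => x XY Dx.
  have /cvg_limn_einf_sup[-> _]// : (X n x ^+ 2)%:E @[n --> \oo] --> (Y x ^+ 2)%:E.
  apply: cvg_EFin; first exact: nearW.
  exact: (cvg_comp _ _ (XY Dx) (@exprn_continuous _ 2 (Y x))).
apply: le_trans (fatou _ mD _ _) _.
- by move=> n; exact: m2.
- by move=> n x _; rewrite lee_fin sqr_ge0.
rewrite limn_einf_lim; apply: lime_le; first exact: is_cvg_einfs.
by apply: nearW => n; apply: ereal_inf_le; exists (sqint (X n)) => //; exists n => /=.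
Qed.

End square_integral.

(** * Wiener integrals as limits of step integrals *)

Section wiener_pairs.
Context d (Omega : measurableType d) (R : realType) (P : probability Omega R).
Variables (B : R -> {RV P >-> R}) (B_wiener : is_wiener B) (u : R).
Notation c := (normal_second_moment R).
Notation leb := (@lebesgue_measure R).
Notation I := (`[0, u]%classic : set R).
Implicit Types (f g : R -> R) (X Y : Omega -> R).

Let mI : measurable I. Proof. by []. Qed.
Let mT : measurable [set: Omega]. Proof. by []. Qed.

(** X is the integral over [0, u] of the deterministic function f against B: the
    same step functions approximate f in L^2([0, u]) and X in L^2(P). *)
Record wiener_integral f X : Prop := WienerIntegral {
  wiener_integrand_measurable : measurable_fun I f ;
  wiener_integral_measurable : measurable_fun setT X ;
  wiener_integral_approx : forall e : R, 0 < e -> exists h : seq (R * R * R),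
    [/\ step_on u h,
        (sqint leb I (fun x => (step_fun h x - f x)%R) <= e%:E)%E &
        (sqint P setT (fun w => (step_integral (fun t => B t) h w - X w)%R) <= e%:E)%E]
}.

Lemma wiener_integral_eq f g X :
  {in I, f =1 g} -> wiener_integral f X -> wiener_integral g X.
Proof.
move=> fg [mf mX ap]; split=> //; first exact: eq_measurable_fun mf.
move=> e /ap[h [hu he hX]]; exists h; split=> //.
by apply: eq_sqint_le he => x xI; rewrite fg.
Qed.

Lemma step_wiener_integral h : step_on u h ->
  wiener_integral (step_fun h) (step_integral (fun t => B t) h).
Proof.
move=> hu; split; [exact: measurable_step_fun|exact: measurable_step_integral|].
move=> e e0; exists h; split => //.
  by rewrite /sqint; under eq_integral do rewrite subrr expr0n/=; rewrite integral0 lee_fin ltW.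
by rewrite /sqint; under eq_integral do rewrite subrr expr0n/=; rewrite integral0 lee_fin ltW.
Qed.

(** Concatenating the lists of two step functions adds both the functions and the
    integrals. *)
Lemma wiener_integral_lincomb (a : R) f g X Y :
  wiener_integral f X -> wiener_integral g Y ->
  wiener_integral (fun x => a * f x + g x) (fun w => a * X w + Y w).
Proof.
move=> [mf mX apf] [mg mY apg]; split.
- by apply: measurable_funD => //; exact: measurable_funM.
- by apply: measurable_funD => //; exact: measurable_funM.
move=> e e0.
have a0 : 0 < 2 * a ^+ 2 + 2 by have := sqr_ge0 a; lra.
have [h [hu hf hX]] := apf (e / (2 * a ^+ 2 + 2)) (divr_gt0 e0 a0).
have [k [ku kg kY]] := apg (e / (2 * a ^+ 2 + 2)) (divr_gt0 e0 a0).
have eE : e = 2 * a ^+ 2 * (e / (2 * a ^+ 2 + 2)) + 2 * (e / (2 * a ^+ 2 + 2)).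
  by field; rewrite gt_eqF.
have catE (V : Type) (F : R * R * R -> V -> R) (x : V) :
    (forall i, F (i.1, a * i.2) x = a * F i x) ->
    \sum_(i <- [seq (i.1, a * i.2) | i <- h] ++ k) F i x =
    a * \sum_(i <- h) F i x + \sum_(i <- k) F i x.
  by move=> Fa; rewrite big_cat/= big_map big_distrr/=; congr (_ + _); apply: eq_bigr => i _.
exists ([seq (i.1, a * i.2) | i <- h] ++ k); split.
- move=> i; rewrite mem_cat => /orP[/mapP[j /hu jh ->]|/ku]//.
- apply: (@eq_sqint_le _ _ _ leb I (fun x =>
     a * (step_fun h x - f x) + (step_fun k x - g x))); last first.
    rewrite [in leRHS]eE.
    by apply: sqint_lincomb => //; apply: measurable_funB => //; exact: measurable_step_fun.
  move=> x _; rewrite /step_fun.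
  rewrite (catE R (fun i x => i.2 * \1_(`]i.1.1, i.1.2]%classic) x)) /=; last first.
    by move=> i; rewrite mulrA.
  by ring.
- apply: (@eq_sqint_le _ _ _ P setT (fun w =>
     a * (step_integral (fun t => B t) h w - X w) +
     (step_integral (fun t => B t) k w - Y w))); last first.
    rewrite [in leRHS]eE.
    by apply: sqint_lincomb => //; apply: measurable_funB => //; exact: measurable_step_integral.
  move=> x _; rewrite /step_integral.
  rewrite (catE Omega (fun i w => i.2 * (B i.1.2 w - B i.1.1 w))) /=; last first.
    by move=> i; rewrite mulrA.
  by ring.
Qed.

Lemma wiener_integralB f g X Y :
  wiener_integral f X -> wiener_integral g Y ->
  wiener_integral (fun x => f x - g x) (fun w => X w - Y w).
Proof.
move=> fX gY.
have := wiener_integral_lincomb (-1) gY fX.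
rewrite (_ : (fun w => -1 * Y w + X w) = (fun w => X w - Y w)); last first.
  by apply/funext => w; rewrite mulN1r addrC.
by apply: wiener_integral_eq => x _; rewrite mulN1r addrC.
Qed.

Lemma wiener_integral0 : wiener_integral (fun=> 0) (fun=> 0).
Proof.
have := @step_wiener_integral [::] _.
rewrite (_ : step_fun _ = fun=> 0); last first.
  by apply/funext => x; rewrite /step_fun big_nil.
rewrite (_ : step_integral _ _ = fun=> 0); last first.
  by apply/funext => x; rewrite /step_integral big_nil.
by apply => i; rewrite in_nil.
Qed.

Lemma wiener_integral_sum (J : Type) (s : seq J) (a : J -> R)
    (f : J -> R -> R) (X : J -> Omega -> R) :
  (forall j, wiener_integral (f j) (X j)) ->
  wiener_integral (fun x => \sum_(j <- s) a j * f j x) (fun w => \sum_(j <- s) a j * X j w).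
Proof.
move=> fX; elim: s => [|j s IH].
  under eq_fun do rewrite big_nil; under [X in wiener_integral _ X]eq_fun do rewrite big_nil.
  exact: wiener_integral0.
under eq_fun do rewrite big_cons; under [X in wiener_integral _ X]eq_fun do rewrite big_cons.
exact: wiener_integral_lincomb.
Qed.

(** The isometry, passed to the limit; the factor 4 comes from the two uses of
    (x + y)^2 <= 2 x^2 + 2 y^2. *)
Lemma wiener_integral_sqint f X (v : R) : wiener_integral f X ->
  (sqint leb I f <= v%:E)%E -> (sqint P setT X <= (4 * c * v)%:E)%E.
Proof.
move=> [mf mX ap] fv; apply/lee_addgt0Pr => e e0.
have c0 := normal_second_moment_ge0 R.
have c4 : 0 < 4 * c + 2 by lra.
have [h [hu hf hX]] := ap (e / (4 * c + 2)) (divr_gt0 e0 c4).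
set e' := e / (4 * c + 2) in hf hX.
have mh := @measurable_step_fun R I h.
have mS := measurable_step_integral B h.
have hv : (sqint leb I (step_fun h) <= (2 * e' + 2 * v)%:E)%E.
  have := @sqint_lincomb _ _ _ leb I mI 1 _ _ e' v (measurable_funB mh mf) mf hf fv.
  rewrite expr1n mulr1; apply: eq_sqint_le => x _.
  by rewrite mul1r subrK.
have Sv : (sqint P setT (step_integral (fun t => B t) h) <= (c * (2 * e' + 2 * v))%:E)%E.
  by rewrite /sqint (step_integral_isometry B_wiener hu) EFinM lee_wpmul2l// lee_fin.
have := @sqint_lincomb _ _ _ P setT mT (-1) _ _ e' _ (measurable_funB mS mX) mS hX Sv.
rewrite sqrrN expr1n mulr1.
have -> : (fun w => -1 * (step_integral (fun t => B t) h w - X w) +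
    step_integral (fun t => B t) h w) = X.
  by apply/funext => w; rewrite mulN1r opprB subrK.
move=> /le_trans; apply; rewrite -EFinD lee_fin.
have -> : e = (4 * c + 2) * e' by rewrite /e' mulrCA divff ?mulr1// gt_eqF.
by lra.
Qed.

Lemma wiener_integral_closed f X :
  measurable_fun I f -> measurable_fun setT X ->
  (forall e : R, 0 < e -> exists g Y, [/\ wiener_integral g Y,
     (sqint leb I (fun x => (g x - f x)%R) <= e%:E)%E &
     (sqint P setT (fun w => (Y w - X w)%R) <= e%:E)%E]) ->
  wiener_integral f X.
Proof.
move=> mf mX ap; split=> // e e0.
have e4 : 0 < e / 4 by rewrite divr_gt0.
have [g [Y [[mg mY apY] gf YX]]] := ap _ e4.
have [h [hu hg hY]] := apY _ e4.
have eE : e = 2 * (e / 4) + 2 * (e / 4) by field.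
exists h; split => //; rewrite eE.
  by apply: sqint_sub hg gf => //; exact: measurable_step_fun.
by apply: sqint_sub hY YX => //; exact: measurable_step_integral.
Qed.

(** By [wiener_integral_sqint] the X n form a Cauchy sequence in L^2(P), and by
    Fatou's lemma their almost sure limit is also their L^2 limit. *)
Lemma wiener_integral_lim (f : nat -> R -> R) (X : nat -> Omega -> R) g Y :
  (forall n, wiener_integral (f n) (X n)) ->
  measurable_fun I g -> measurable_fun setT Y ->
  (forall e : R, 0 < e -> \forall n \near \oo,
     (sqint leb I (fun x => (f n x - g x)%R) <= e%:E)%E) ->
  {ae P, forall w, X n w @[n --> \oo] --> Y w} ->
  wiener_integral g Y.
Proof.
move=> fX mg mY fg XY; apply: wiener_integral_closed => // e e0.
have c0 := normal_second_moment_ge0 R.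
have c4 : 0 < 16 * c + 1 by lra.
pose e' := e / (16 * c + 1).
have e'0 : 0 < e' by rewrite divr_gt0.
have eE : e = (16 * c + 1) * e' by rewrite /e' mulrCA divff ?mulr1// gt_eqF.
have [N _ Nfg] := fg _ e'0.
exists (f N), (X N); split => //.
  apply: (le_trans (Nfg N (leqnn N))); rewrite lee_fin eE mulrDl mul1r lerDr.
  by apply: mulr_ge0; [lra|exact: ltW].
have mf n := wiener_integrand_measurable (fX n).
have mX n := wiener_integral_measurable (fX n).
apply: (@sqint_fatou _ _ _ P setT mT (fun n w => X N w - X (n + N)%N w)).
- by move=> n; exact: measurable_funB.
- exact: measurable_funB.
- apply: filterS XY => w Xw _; apply: cvgB; first exact: cvg_cst.
  by rewrite (cvg_shiftn N (fun n => X n w)).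
move=> n.
have : (sqint leb I (fun x => (f N x - f (n + N)%N x)%R) <= (2 * e' + 2 * e')%:E)%E.
  apply: (@sqint_sub _ _ _ leb I mI (f N) g (f (n + N)%N) e' e');
    [exact: mf|exact: mg|exact: mf|exact: (Nfg N (leqnn N))|].
  have := Nfg (n + N)%N (leq_addl _ _).
  rewrite -sqintN; apply: eq_sqint_le => x _; rewrite opprB//.
move=> /(wiener_integral_sqint (wiener_integralB (fX N) (fX (n + N)%N))).
by move=> /le_trans; apply; rewrite lee_fin eE; nra.
Qed.

(** From |x| <= r + x^2 / r. *)
Lemma integral_abs_le X (v r : R) : 0 < r -> measurable_fun setT X ->
  (sqint P setT X <= v%:E)%E -> (\int[P]_w `|(X w)%:E| <= (r + v / r)%:E)%E.
Proof.
move=> r0 mX Xv.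
have mX2 : measurable_fun setT (fun w => (X w ^+ 2)%:E).
  exact/measurable_EFinP/measurable_funX.
apply: (@le_trans _ _ (\int[P]_w (r%:E + (r^-1)%:E * (X w ^+ 2)%:E))%E).
  apply: ge0_le_integral => //.
  - by apply: measurableT_comp => //; exact/measurable_EFinP.
  - by apply: emeasurable_funD => //; exact: measurable_funeM.
  - move=> w _; rewrite -EFinM -EFinD lee_fin.
    rewrite -(ler_pM2l r0) mulrDr mulrA divff ?gt_eqF// mul1r.
    have := sqr_ge0 (`|X w| - r); rewrite -[X w ^+ 2]real_normK ?num_real//.
    have := mulr_ge0 (ltW r0) (normr_ge0 (X w)); lra.
rewrite ge0_integralD//.
- rewrite integral_cst//= probability_setT mule1 ge0_integralZl//; last first.
  + by rewrite lee_fin invr_ge0 ltW.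
  + by move=> w _; rewrite lee_fin sqr_ge0.
  rewrite EFinD leeD2l// mulrC EFinM lee_wpmul2l// lee_fin invr_ge0 ltW//.
- by move=> w _; rewrite lee_fin ltW.
- by move=> w _; apply: mule_ge0; rewrite lee_fin ?sqr_ge0// invr_ge0 ltW.
- exact: measurable_funeM.
Qed.

(** Step integrals have mean 0, and L^2 convergence implies convergence of the
    means. *)
Lemma wiener_integral_mean0 f X (v : R) : wiener_integral f X ->
  (sqint leb I f <= v%:E)%E ->
  P.-integrable setT (EFin \o X) /\ (\int[P]_w (X w)%:E = 0)%E.
Proof.
move=> fX fv; have [mf mX ap] := fX.
have intX : P.-integrable setT (EFin \o X).
  apply/integrableP; split; first exact/measurable_EFinP.
  apply: le_lt_trans (integral_abs_le ltr01 mX (wiener_integral_sqint fX fv)) _.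
  by rewrite ltry.
split => //.
have small (r : R) : 0 < r -> (`|\int[P]_w (X w)%:E| <= (2 * r)%:E)%E.
  move=> r0; have [h [hu _ hX]] := ap _ (mulr_gt0 r0 r0).
  have [intS S0] := integrable_step_integral B_wiener hu.
  have -> : (\int[P]_w (X w)%:E = - \int[P]_w (step_integral (fun t => B t) h w - X w)%:E)%E.
    under [in RHS]eq_integral do rewrite EFinB.
    by rewrite integralB// [X in (X - _)%E]S0 add0e oppeK.
  rewrite abseN; apply: le_trans (le_abse_integral _ _ _) _ => //.
    by apply/measurable_EFinP/measurable_funB => //; exact: measurable_step_integral.
  have := integral_abs_le r0 (measurable_funB (measurable_step_integral B h) mX) hX.
  move=> /le_trans; apply; rewrite lee_fin mulfK ?gt_eqF//; lra.
have := integrable_fin_num measurableT intX.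
move: small; rewrite /comp; case: (\int[P]_w (X w)%:E)%E => // r small _.
congr EFin; apply/eqP; rewrite -normr_eq0 eq_le normr_ge0 andbT.
apply/ler_addgt0Pr => e e0; rewrite add0r.
have e2 : 0 < e / 2 by rewrite divr_gt0.
by have := small (e / 2) e2; rewrite lee_fin mulrC divfK.
Qed.

End wiener_pairs.

(** * Independence and Ottaviani's inequality *)

Lemma measurable_gt_normr d (T : measurableType d) (R : realType)
    (Y : T -> R) (r : R) : measurable_fun setT Y ->
  measurable [set x | r < `|Y x|].
Proof.
move=> mY.
rewrite (_ : [set _ | _] = (fun x => `|Y x|) @^-1` `]r, +oo[%classic).
  by rewrite -[X in measurable X]setTI; apply: measurableT_comp.
by apply/seteqP; split => x /=; rewrite in_itv/= andbT.
Qed.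

Lemma chebyshev_sqint d (T : measurableType d) (R : realType)
    (mu : {measure set T -> \bar R}) (Y : T -> R) (V r : R) : 0 < r ->
  measurable_fun setT Y -> (sqint mu setT Y <= V%:E)%E ->
  (mu [set x | (r < `|Y x|)%R] <= (V / r ^+ 2)%:E)%E.
Proof.
move=> r0 mY YV; set A := [set x | _].
have mA : measurable A by exact: measurable_gt_normr.
have r2 : 0 < r ^+ 2 by rewrite exprn_gt0.
rewrite mulrC EFinM -lee_pdivrMl ?invr_gt0// invrK.
apply: le_trans YV.
rewrite -integral_cst//.
apply: (@le_trans _ _ (\int[mu]_(x in A) (Y x ^+ 2)%:E)%E).
  apply: ge0_le_integral => //.
  - by move=> x _; rewrite lee_fin ltW.
  - by apply/measurable_EFinP/measurable_funTS/measurable_funX.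
  - move=> x rx; rewrite lee_fin -[leRHS]real_normK ?num_real//.
    by rewrite lerXn2r ?nnegrE ?(ltW r0)// ltW.
apply: ge0_subset_integral => //.
- by apply/measurable_EFinP/measurable_funX.
- by move=> x _; rewrite lee_fin sqr_ge0.
Qed.

Section independence.
Context d (Omega : measurableType d) (R : realType) (P : probability Omega R).
Variables (N : nat) (X : nat -> Omega -> R).
Hypothesis mX : forall i, measurable_fun setT (X i).
Hypothesis indX : mutually_independent P (fun i : 'I_N => X i).

(** The pi-system that generates the sigma-algebra of the X i with i in D. *)
Definition cylinders (D : set nat) : set (set Omega) :=
  [set E | exists2 A : nat -> set R, (forall i, measurable (A i)) &
     E = [set w | forall i, (i < N)%N -> D i -> A i (X i w)]].

Lemma cylinders_measurable D : cylinders D `<=` measurable.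
Proof.
move=> _ [A mA ->].
rewrite (_ : [set w | _] =
    \bigcap_(i in [set i | (i < N)%N /\ D i]) (X i @^-1` A i)); last first.
  by apply/seteqP; split => w /= h i; [move=> [iN Di]; exact: h|move=> iN Di; apply: h].
apply: bigcap_measurableType => i _.
by rewrite -[X in measurable X]setTI; exact: mX.
Qed.

Lemma cylinders_setI D : setI_closed (cylinders D).
Proof.
move=> _ _ [A mA ->] [A' mA' ->]; exists (fun i => A i `&` A' i).
  by move=> i; exact: measurableI.
apply/seteqP; split => w /=.
  by move=> [h h'] i iN Di; split; [exact: h|exact: h'].
by move=> h; split=> i iN Di; have [] := h i iN Di.
Qed.

Lemma cylinders_setT D : cylinders D setT.
Proof. by exists (fun=> setT) => //; apply/seteqP; split. Qed.

Lemma independent_cylinders D E F : cylinders D E -> cylinders (~` D) F ->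
  P (E `&` F) = (P E * P F)%E.
Proof.
move=> [A mA ->] [A' mA' ->].
pose C i := if i \in D then A i else A' i.
pose CA i := if i \in D then A i else setT.
pose CA' i := if i \in D then setT else A' i.
have mC i : measurable (C i) by rewrite /C; case: ifP.
have mCA i : measurable (CA i) by rewrite /CA; case: ifP.
have mCA' i : measurable (CA' i) by rewrite /CA'; case: ifP.
rewrite (_ : [set w | forall i, (i < N)%N -> D i -> A i (X i w)] =
  [set w | forall i : 'I_N, CA i (X i w)]); last first.
  apply/seteqP; split => w /= h.
    by move=> i; rewrite /CA; case: ifPn => // /set_mem; exact: h.
  by move=> i iN Di; have := h (Ordinal iN); rewrite /CA/= mem_set.
rewrite (_ : [set w | forall i, (i < N)%N -> (~` D) i -> A' i (X i w)] =
  [set w | forall i : 'I_N, CA' i (X i w)]); last first.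
  apply/seteqP; split => w /= h.
    move=> i; rewrite /CA'; case: ifPn => // nD; apply: h => //= Di.
    by move: nD; rewrite mem_set.
  move=> i iN Di; have := h (Ordinal iN); rewrite /CA'/=; case: ifPn => //.
  by move=> /set_mem.
rewrite (_ : _ `&` _ = [set w | forall i : 'I_N, C i (X i w)]); last first.
  apply/seteqP; split => w /=.
    move=> [h h'] i; have := h i; have := h' i; rewrite /CA /CA' /C.
    by case: ifPn.
  by move=> h; split=> i; have := h i; rewrite /CA /CA' /C; case: ifPn.
rewrite (indX (fun i => mC i)) (indX (fun i => mCA i)) (indX (fun i => mCA' i)).
rewrite -big_split/=; apply: eq_bigr => i _.
rewrite /C /CA /CA'; case: ifP => _; by rewrite preimage_setT probability_setT ?mule1 ?mul1e.
Qed.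

(** Two applications of uniqueness of measures on a pi-system: first the event in
    the past varies while the one in the future is a cylinder, then conversely. *)
Lemma independent_sigma D E F :
  <<s cylinders D >> E -> <<s cylinders (~` D) >> F ->
  P (E `&` F) = (P E * P F)%E.
Proof.
have step (D2 : set nat) (E1 : set Omega) : measurable E1 ->
    (forall F1, cylinders D2 F1 -> P (F1 `&` E1) = (P E1 * P F1)%E) ->
    forall F1, <<s cylinders D2 >> F1 -> P (F1 `&` E1) = (P E1 * P F1)%E.
  move=> mE1 h F1 sF1.
  have PE : P E1 = (fine (P E1))%:E by rewrite fineK// fin_num_measure.
  pose k : {nonneg R} := NngNum (fine_ge0 (measure_ge0 P E1)).
  rewrite PE; apply: (@g_sigma_algebra_measure_unique _ _ _ (cylinders D2)
    (@cylinders_measurable D2) (fun=> setT) (fun=> cylinders_setT D2) _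
    (mrestr P mE1) (mscale k P) (@cylinders_setI D2) _ _ F1 sF1).
  - by rewrite bigcup_const.
  - move=> A cA; transitivity (P E1 * P A)%E; first exact: h.
    by rewrite [in LHS]PE.
  - move=> _; apply: (@le_lt_trans _ _ (P (setT `&` E1))) => //.
    by rewrite setTI PE ltry.
have sm D0 : <<s cylinders D0 >> `<=` measurable.
  by apply: smallest_sub => //; [exact: sigma_algebra_measurable|exact: cylinders_measurable].
move=> sE sF; rewrite setIC.
apply: (step (~` D)) => //; first exact: sm sE.
move=> F1 cF1; rewrite setIC muleC; apply: (step D) => //.
  exact: cylinders_measurable cF1.
by move=> E1 cE1; rewrite (independent_cylinders cE1 cF1) muleC.
Qed.

Lemma cylinders_measurable_fun D i : (i < N)%N -> D i ->
  measurable_fun [set: g_sigma_algebraType (cylinders D)]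
    (X i : g_sigma_algebraType (cylinders D) -> R).
Proof.
move=> iN Di _ A mA; rewrite setTI; apply: sub_sigma_algebra.
exists (fun j => if j == i then A else setT); first by move=> j; case: ifP.
apply/seteqP; split => w /=; last by move=> /(_ i iN Di); rewrite eqxx.
by move=> Aw j _ _; case: ifPn => // /eqP ->.
Qed.

End independence.

Section ottaviani.
Context d (Omega : measurableType d) (R : realType) (P : probability Omega R).
Variables (N : nat) (X : nat -> Omega -> R).
Hypothesis mX : forall i, measurable_fun setT (X i).
Hypothesis indX : mutually_independent P (fun i : 'I_N => X i).

Let S k w := \sum_(0 <= i < k) X i w.
Let past k : set nat := [set i | (i < k)%N].

Let mS k : measurable_fun setT (S k).
Proof. exact: measurable_sum. Qed.

Let past_sum k j r : (k <= N)%N -> (j <= k)%N ->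
  <<s cylinders N X (past k) >> [set w | r < `|S j w|].
Proof.
move=> kN jk; pose T := g_sigma_algebraType (cylinders N X (past k)).
have mSj : measurable_fun [set: T] (S j : T -> R).
  rewrite /S; under eq_fun do rewrite big_mkord.
  apply: measurable_sum => i; apply: cylinders_measurable_fun.
    exact: leq_trans (leq_trans (ltn_ord i) jk) kN.
  exact: leq_trans (ltn_ord i) jk.
have mn : measurable_fun [set: T] (fun w : T => `|S j w|) by exact: measurableT_comp.
rewrite (_ : [set w | _] = [set: T] `&` (fun w : T => `|S j w|) @^-1` `]r, +oo[%classic).
  exact: mn.
by rewrite setTI; apply/seteqP; split => x /=; rewrite in_itv/= andbT.
Qed.

Let future_sum k r : (k <= N)%N ->
  <<s cylinders N X (~` past k) >> [set w | `|S N w - S k w| <= r].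
Proof.
move=> kN; pose T := g_sigma_algebraType (cylinders N X (~` past k)).
have mSj : measurable_fun [set: T] (fun w : T => S N w - S k w).
  have -> : (fun w => S N w - S k w) = (fun w => \sum_(i < N - k) X (i + k)%N w).
    apply/funext => w; rewrite /S (@big_cat_nat _ _ _ k)//= addrAC subrr add0r.
    by rewrite -{1}[k]add0n big_addn big_mkord.
  apply: measurable_sum => i; apply: cylinders_measurable_fun.
    by have := ltn_ord i; rewrite ltn_subRL addnC.
  by rewrite /past/=; apply/negP; rewrite -leqNgt leq_addl.
have mn : measurable_fun [set: T] (fun w : T => `|S N w - S k w|) by exact: measurableT_comp.
rewrite (_ : [set w | _] = [set: T] `&` (fun w : T => `|S N w - S k w|) @^-1` `]-oo, r]%classic).
  exact: mn.
by rewrite setTI; apply/seteqP; split => x /=; rewrite in_itv/=.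
Qed.

(** Let k be the first index with |S_k| > 2 r.  This event depends on the past of k,
    so it is independent of |S_N - S_k| <= r, which by Chebyshev has probability at
    least 1/2 as soon as V / r^2 <= 1/2.  On both events |S_N| > r.  Hence the
    probability of the maximum exceeding 2 r is at most 2 P(|S_N| > r). *)
Lemma ottaviani (V r : R) : 0 < r ->
  (forall k, (k <= N)%N -> (sqint P setT (fun w => (S N w - S k w)%R) <= V%:E)%E) ->
  (P (\big[setU/set0]_(k < N.+1) [set w | (2 * r < `|S k w|)%R]) <= (2 * V / r ^+ 2)%:E)%E.
Proof.
move=> r0 SV; set E := fun k => [set w | 2 * r < `|S k w|].
have mE k : measurable (E k) by exact: measurable_gt_normr.
have tail k : (k <= N)%N -> (P [set w | (r < `|S N w - S k w|)%R] <= (V / r ^+ 2)%:E)%E.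
  by move=> kN; apply: chebyshev_sqint (SV k kN) => //; exact: measurable_funB.
(* If V / r^2 > 1/2 the bound exceeds 1. *)
have [small|big] := leP (V / r ^+ 2) (2^-1); last first.
  apply: (@le_trans _ _ 1%E).
    by apply: probability_le1; apply: bigsetU_measurable => k _; exact: mE.
  by rewrite lee_fin -mulrA; lra.
pose E' := [set w | r < `|S N w|].
have mE' : measurable E' by exact: measurable_gt_normr.
have PE' : (P E' <= (V / r ^+ 2)%:E)%E.
  have := tail 0%N (leq0n N); congr (P _ <= _)%E.
  have S0 w : S 0%N w = 0 by rewrite /S big_geq.
  by apply/seteqP; split => w /=; rewrite S0 subr0.
(* [seqDU E k] is the event that k is the first index in E. *)
have step k : (k < N.+1)%N -> (P (seqDU E k) <= 2%:E * P (seqDU E k `&` E'))%E.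
  rewrite ltnS => kN.
  pose G := [set w | `|S N w - S k w| <= r].
  have mD : measurable (seqDU E k) by exact: seqDU_measurable.
  have mG : measurable G.
    rewrite (_ : G = ~` [set w | r < `|S N w - S k w|]).
      by apply: measurableC; apply: measurable_gt_normr; exact: measurable_funB.
    by apply/seteqP; split => w /=; rewrite ltNge; [move=> -> //|move/negP; rewrite negbK].
  have PG : (2^-1%:E <= P G)%E.
    rewrite (_ : G = ~` [set w | r < `|S N w - S k w|]); last first.
      by apply/seteqP; split => w /=; rewrite ltNge; [move=> -> //|move/negP; rewrite negbK].
    rewrite probability_setC; last by apply: measurable_gt_normr; exact: measurable_funB.
    have := tail k kN.
    have : P [set w | r < `|S N w - S k w|] \is a fin_num.
      by rewrite fin_num_measure//; apply: measurable_gt_normr; exact: measurable_funB.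
    case: (P _) => // p _; rewrite -EFinB !lee_fin; lra.
  have sD : <<s cylinders N X (past k) >> (seqDU E k).
    rewrite /seqDU.
    pose T := g_sigma_algebraType (cylinders N X (past k)).
    apply: (@measurableD _ T); first exact: past_sum.
    apply: (@bigsetU_measurable _ T) => i _; apply: past_sum => //.
    exact: ltnW.
  have ind := independent_sigma mX indX sD (future_sum r kN).
  apply: (@le_trans _ _ (2%:E * (P (seqDU E k) * P G))%E).
    have : (0 <= P (seqDU E k))%E by [].
    have : P (seqDU E k) \is a fin_num by rewrite fin_num_measure.
    have : P G \is a fin_num by rewrite fin_num_measure.
    move: PG; case: (P G) => // p; case: (P (seqDU E k)) => // q.
    rewrite -!EFinM !lee_fin => ? _ _ ?; nra.
  rewrite lee_wpmul2l// -ind; apply: le_measure; rewrite ?inE.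
  - exact: measurableI.
  - exact: measurableI.
  move=> w [Dw Gw]; split => //; rewrite /E'/=.
  have : 2 * r < `|S k w| by have [] := Dw.
  have tri := ler_normD (S N w) (S k w - S N w).
  rewrite addrC subrK distrC in tri.
  move: Gw => /= Gw lt2; lra.
rewrite (bigsetU_seqDU E N.+1) measure_bigsetU; last 2 first.
- by move=> i; exact: seqDU_measurable.
- exact: trivIset_seqDU.
apply: (@le_trans _ _ (\sum_(k < N.+1) 2%:E * P (seqDU E k `&` E'))%E).
  by apply: lee_sum => k _; exact: step.
rewrite -ge0_sume_distrr; last by [].
rewrite -mulrA EFinM lee_wpmul2l//; apply: le_trans PE'.
rewrite -(@measure_bigsetU _ _ _ P (fun k => seqDU E k `&` E')).
- apply: le_measure; rewrite ?inE//.
    by apply: bigsetU_measurable => i _; apply: measurableI => //; exact: seqDU_measurable.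
  by rewrite -(bigcup_mkord _ (fun k => seqDU E k `&` E')) => w [k _ []].
- by move=> i; apply: measurableI => //; exact: seqDU_measurable.
- by apply: trivIset_setIr; exact: trivIset_seqDU.
Qed.

End ottaviani.

(** * Continuous functions on a segment and their grid approximations *)

Section segments.
Context (R : realType).
Implicit Types (f : R -> R) (a b : R).

(** Compactness of the segment in the form of near-coverings: the filter of small
    mesh sizes is uniform over a compact set of points. *)
Lemma segment_uniform_continuity f a b : {within `[a, b], continuous f} ->
  forall e : R, 0 < e -> exists2 dl : R, 0 < dl &
    forall x y, x \in `[a, b] -> y \in `[a, b] -> `|x - y| <= dl -> `|f x - f y| <= e.
Proof.
move=> cf e e0.
have /compact_near_coveringP cK := @segment_compact R a b.
pose Q (dl : R) (x : R) := `[a, b]%classic x ->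
  forall y, y \in `[a, b] -> `|x - y| <= dl -> `|f x - f y| <= e.
have : \forall dl \near 0^'+, `[a, b]%classic `<=` Q dl.
  apply: cK => x Kx.
  have /subspace_continuousP/(_ x Kx)/cvgrPdist_le/(_ (e / 2)) := cf.
  have e2 : 0 < e / 2 by rewrite divr_gt0.
  move=> /(_ e2); rewrite near_withinE near_simpl => /nbhs_ballP[rho /= rho0 hrho].
  have r2 : 0 < rho / 2 by rewrite divr_gt0.
  near=> x' dl => Kx' y Ky x'y.
  have dl2 : dl < rho / 2 by near: dl; exact: nbhs_right_lt.
  have xx' : `|x - x'| < rho / 2.
    by near: x'; exact: (nbhsx_ballx x _ r2).
  have xy : `|x - y| < rho.
    apply: le_lt_trans (ler_distD x' x y) _; rewrite [ltRHS]splitr.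
    exact: ltr_leD xx' (le_trans x'y (ltW dl2)).
  have h1 : `|f x - f x'| <= e / 2.
    by apply: hrho Kx'; rewrite /ball/=; lra.
  have h2 : `|f x - f y| <= e / 2 by apply: hrho => //; rewrite inE.
  rewrite (le_trans (ler_distD (f x) _ _))// distrC [leRHS]splitr lerD//.
move=> h; near (0 : R)^'+ => dl; exists dl; first by near: dl; exact: nbhs_right_gt.
move=> x y xab yab; have : `[a, b]%classic `<=` Q dl by near: dl.
by move=> /(_ x xab); apply.
Unshelve. all: by end_near. Qed.

Lemma segment_bounded f a b : {within `[a, b], continuous f} ->
  exists2 F : R, 0 <= F & forall x, x \in `[a, b] -> `|f x| <= F.
Proof.
move=> cf; have [ab|ba] := leP a b; last first.
  exists 0 => // x; rewrite in_itv/= => /andP[ax xb].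
  by have := lt_le_trans ba (le_trans ax xb); rewrite ltxx.
have cn : {within `[a, b], continuous (fun x => `|f x|)}.
  by move=> x; apply: continuous_comp; [exact: cf|exact: norm_continuous].
have [x0 _ Fmax] := EVT_max ab cn.
by exists `|f x0|.
Qed.

End segments.

Section grids.
Context (R : realType).
Implicit Types (t a : nat -> R) (u x : R).

(** The step function with value a i on ]t i, t (i + 1)] for i < k, in the list
    encoding of step functions. *)
Definition grid_step t a k : seq (R * R * R) :=
  [seq ((t i, t i.+1), a i) | i <- iota 0 k].

Lemma grid_stepS t a k :
  grid_step t a k.+1 = rcons (grid_step t a k) ((t k, t k.+1), a k).
Proof. by rewrite /grid_step -[k.+1]addn1 iotaD map_cat add0n -cats1 addn1. Qed.

Lemma step_on_grid_step t a k u : nondecreasing_seq t -> 0 <= t 0%N -> t k <= u ->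
  step_on u (grid_step t a k).
Proof.
move=> ndt t0 tk i /mapP[j]; rewrite mem_iota add0n => /andP[_ jk] -> /=.
split; [by rewrite (le_trans t0)// ndt|exact: ndt|exact: le_trans (ndt _ _ jk) tk].
Qed.

Lemma step_integral_grid_step (V : Type) (X : R -> V -> R) t a k w :
  step_integral X (grid_step t a k) w =
  \sum_(0 <= i < k) a i * (X (t i.+1) w - X (t i) w).
Proof. by rewrite /step_integral big_map /index_iota subn0. Qed.

Lemma step_fun_grid_step t a k x : nondecreasing_seq t ->
  step_fun (grid_step t a k) x =
    if t 0%N < x <= t k then step_fun (grid_step t a k) x else 0.
Proof.
move=> ndt; case: ifPn => //; elim: k => [|k IH] hx; first by rewrite /step_fun big_nil.
rewrite grid_stepS /step_fun -cats1 big_cat big_seq1 /= -/(step_fun _ _).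
have tk : t k <= t k.+1 by exact: ndt.
have t0k : t 0%N <= t k by exact: ndt.
rewrite IH ?add0r; last first.
  by apply: contra hx => /andP[-> /le_trans->].
rewrite indicE memNset ?mulr0//= in_itv/= => /andP[tkx xtk].
by move: hx; rewrite xtk (le_lt_trans t0k tkx).
Qed.

Lemma step_fun_grid_step_in t a k x : nondecreasing_seq t -> t 0%N < x <= t k ->
  exists2 i, (i < k)%N & t i < x <= t i.+1 /\ step_fun (grid_step t a k) x = a i.
Proof.
move=> ndt; elim: k => [|k IH]; first by case/andP => /lt_le_trans h /h; rewrite ltxx.
move=> /andP[x0 xk]; rewrite grid_stepS /step_fun -cats1 big_cat big_seq1 /= -/(step_fun _ _).
have [xtk|tkx] := leP x (t k).
  have [|i ik [xi ->]] := IH; first by rewrite x0 xtk.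
  exists i; first exact: ltnW. split=> //.
  rewrite indicE memNset ?mulr0 ?addr0//= in_itv/= => /andP[/lt_le_trans/(_ xtk)].
  by rewrite ltxx.
exists k => //; split; first by rewrite tkx.
rewrite step_fun_grid_step// ifF; last by apply/negP => /andP[_ /le_lt_trans/(_ tkx)]; rewrite ltxx.
by rewrite add0r indicE mem_set ?mulr1//= in_itv/= tkx.
Qed.

Definition grid u (N : nat) (i : nat) : R := i%:R * (u / N.+1%:R).

Lemma grid0 u N : grid u N 0%N = 0.
Proof. by rewrite /grid mul0r. Qed.

Lemma gridS u N i : grid u N i.+1 = grid u N i + u / N.+1%:R.
Proof. by rewrite /grid -natr1 mulrDl mul1r. Qed.

Lemma grid_last u N : grid u N N.+1 = u.
Proof. by rewrite /grid mulrC divfK. Qed.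

Lemma grid_nondecreasing u N : 0 <= u -> nondecreasing_seq (grid u N).
Proof.
move=> u0; apply/nondecreasing_seqP => i.
by rewrite gridS lerDl divr_ge0.
Qed.

Lemma grid_floor u N s : 0 <= s <= u ->
  exists2 k, (k <= N)%N & grid u N k <= s <= grid u N k + u / N.+1%:R.
Proof.
move=> /andP[s0 su]; have u0 := le_trans s0 su.
have : exists k, (k <= N)%N && (s <= grid u N k.+1).
  by exists N; rewrite leqnn/= grid_last.
move=> /ex_minnP[k /andP[kN sk] kmin]; exists k => //.
rewrite -gridS sk andbT; case: k => [|k] in kN sk kmin *; first by rewrite grid0.
rewrite leNgt; apply/negP => /ltW sk'.
by have := kmin k; rewrite sk' (ltnW kN) ltnn => /(_ isT).
Qed.

Lemma grid_mesh (u dl : R) : 0 < dl -> \forall N \near \oo, u / N.+1%:R <= dl.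
Proof.
move=> dl0; have : u * N.+1%:R^-1 @[N --> \oo] --> u * 0.
  by apply: cvgM; [exact: cvg_cst|exact: cvg_harmonic].
rewrite mulr0 => /cvgrPdist_le/(_ _ dl0); apply: filterS => N.
by rewrite sub0r normrN; exact: le_trans (ler_norm _).
Qed.

End grids.

Section grid_approximation.
Context (R : realType) (u : R).
Hypothesis u0 : 0 <= u.
Notation leb := (@lebesgue_measure R).
Notation I := (`[0, u]%classic : set R).

Let mI : measurable I. Proof. by []. Qed.

Lemma segment_measurable_fun (f : R -> R) : {within I, continuous f} ->
  measurable_fun I f.
Proof. by move=> cf; apply: subspace_continuous_measurable_fun. Qed.

(** On ]0, grid k] the error is small by uniform continuity; on the remaining piece
    ]grid k, s], shorter than one mesh, it is at most the supremum F of |f|. *)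
Lemma sqint_grid_approx (f : R -> R) (e : R) : {within I, continuous f} -> 0 < e ->
  \forall N \near \oo, forall k s,
    grid u N k <= s <= grid u N k + u / N.+1%:R -> s <= u ->
    (sqint leb I (fun x => (f x * \1_(`]0, s]%classic : set R) x -
       step_fun (grid_step (grid u N) (f \o grid u N) k) x)%R) <= e%:E)%E.
Proof.
move=> cf e0.
have [F F0 fF] := segment_bounded cf.
have eta2 : 0 < e / (2 * (u + 1)) by rewrite divr_gt0// mulr_gt0// ltr_wpDl.
pose eta := Num.sqrt (e / (2 * (u + 1))).
have eta0 : 0 < eta by rewrite sqrtr_gt0.
have [dl dl0 fdl] := segment_uniform_continuity cf eta0.
have dl' : 0 < e / (2 * (F ^+ 2 + 1)) by rewrite divr_gt0// mulr_gt0// ltr_wpDl// sqr_ge0.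
near=> N => k s /andP[ks sk] su.
have uN1 : u / N.+1%:R <= dl by near: N; exact: grid_mesh.
have uN2 : u / N.+1%:R <= e / (2 * (F ^+ 2 + 1)) by near: N; exact: grid_mesh.
have ndt := grid_nondecreasing N u0.
have t0 : 0 <= grid u N k by rewrite -(grid0 u N); exact: ndt.
set h := step_fun _.
pose G x := eta ^+ 2 * \1_I x + F ^+ 2 * \1_(`]grid u N k, s]%classic : set R) x.
apply: (@le_trans _ _ (\int[leb]_(x in I) (G x)%:E)%E).
  apply: ge0_le_integral => //.
  - by move=> x _; rewrite lee_fin sqr_ge0.
  - apply/measurable_EFinP/measurable_funX/measurable_funB.
      by apply: measurable_funM; [exact: segment_measurable_fun|exact: measurable_indic].
    exact: measurable_step_fun.
  - apply/measurable_EFinP/measurable_funD; apply: measurable_funM => //; exact: measurable_indic.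
  move=> x /= Ix; rewrite lee_fin /G.
  have Ix' := Ix; rewrite in_itv/= in Ix'; case/andP: Ix' => x0 xu.
  rewrite [\1_I x]indicE mem_set// mulr1.
  have G0 : 0 <= F ^+ 2 * \1_(`]grid u N k, s]%classic : set R) x by rewrite mulr_ge0 ?sqr_ge0.
  have [xs|sx] := leP x s; last first.
    rewrite indicE memNset/=; last by rewrite in_itv/= leNgt sx andbF.
    rewrite /h step_fun_grid_step// ifF; last first.
      by apply/negP => /andP[_ /(le_lt_trans)/(_ (le_lt_trans ks sx))]; rewrite ltxx.
    by rewrite mulr0 subrr expr0n/= addr_ge0// sqr_ge0.
  move: x0; rewrite le_eqVlt => /predU1P[<-|x0].
    rewrite indicE memNset/=; last by rewrite in_itv/= ltxx.
    rewrite /h step_fun_grid_step// grid0 ltxx/=.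
    by rewrite mulr0 subrr expr0n/= addr_ge0 ?sqr_ge0// mulr_ge0 ?sqr_ge0.
  rewrite [\1_(`]0, s]%classic : set R) x]indicE mem_set/= ?in_itv/= ?x0// mulr1.
  have [xk|kx] := leP x (grid u N k).
    have := @step_fun_grid_step_in _ (grid u N) (f \o grid u N) k x ndt.
    rewrite /h grid0 x0 xk => /(_ isT)[i ik [/andP[tix xti] ->]] /=.
    rewrite ler_wpDr// -[leLHS]real_normK ?num_real// lerXn2r ?nnegrE ?(ltW eta0)//.
    apply: fdl.
    - by rewrite in_itv/= xu ltW.
    - rewrite in_itv/= -{1}(grid0 u N) ndt//=.
      by rewrite (le_trans _ xu)// ltW.
    - rewrite ger0_norm ?subr_ge0 ?(ltW tix)//; apply: le_trans uN1.
      by rewrite lerBlDl -gridS.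
  rewrite /h step_fun_grid_step// (leNgt x) kx andbF subr0.
  rewrite indicE mem_set ?mulr1/=; last by rewrite in_itv/= kx.
  rewrite ler_wpDl ?sqr_ge0// -[leLHS]real_normK ?num_real// lerXn2r ?nnegrE//.
  by apply: fF; rewrite in_itv/= xu ltW.
have mb (A : set R) : measurable A -> measurable_fun I (fun x => (\1_A x)%:E : \bar R).
  by move=> mA; apply/measurable_EFinP; exact: measurable_indic.
under eq_integral do rewrite EFinD EFinM (EFinM (F ^+ 2)).
rewrite ge0_integralD//; last 4 first.
- by move=> x _; rewrite mule_ge0// lee_fin ?sqr_ge0.
- by apply: measurable_funeM; exact: mb.
- by move=> x _; rewrite mule_ge0// lee_fin ?sqr_ge0.
- by apply: measurable_funeM; exact: mb.
have sq0 (y : R) : (0 <= (y ^+ 2)%:E)%E by rewrite lee_fin sqr_ge0.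
rewrite !ge0_integralZl//; [|exact: mb|exact: mb].
rewrite !integral_indic// setIid setIidl; last first.
  move=> x /=; rewrite !in_itv/= => /andP[kx xs].
  by rewrite (le_trans t0 (ltW kx)) (le_trans xs su).
rewrite /= !lebesgue_measure_itv/= !lte_fin.
have -> : ((if (0 < u)%R then u%:E - 0%:E else 0) = u%:E)%E.
  by case: ltP => [_|u0']; [rewrite sube0|congr EFin; apply/eqP; rewrite eq_le u0].
have h1 : ((if (grid u N k < s)%R then s%:E - (grid u N k)%:E else 0) <= (u / N.+1%:R)%:E)%E.
  case: ltP => _; last by rewrite lee_fin divr_ge0.
  by rewrite -EFinB lee_fin lerBlDl.
have h2 := lee_wpmul2l (sq0 F) h1.
apply: le_trans (leeD (lexx _) h2) _.
rewrite -!EFinM -EFinD lee_fin /eta sqr_sqrtr ?(ltW eta2)// [leRHS]splitr.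
have eh : 0 <= e / 2 by rewrite divr_ge0// ltW.
apply: lerD.
  have -> : e / (2 * (u + 1)) * u = e / 2 * (u / (u + 1)) by field; lra.
  by rewrite ler_piMr// ler_pdivrMr ?ltr_wpDl// mul1r lerDl.
apply: (le_trans (ler_wpM2l (sqr_ge0 F) uN2)).
have F1 : 0 < F ^+ 2 + 1 by rewrite ltr_wpDl// sqr_ge0.
have -> : F ^+ 2 * (e / (2 * (F ^+ 2 + 1))) = e / 2 * (F ^+ 2 / (F ^+ 2 + 1)) by field; lra.
by rewrite ler_piMr// ler_pdivrMr// mul1r lerDl.
Unshelve. all: by end_near. Qed.

End grid_approximation.

(** * The maximal inequality for Wiener integrals *)

Section maximal.
Context d (Omega : measurableType d) (R : realType) (P : probability Omega R).
Variables (B : R -> {RV P >-> R}) (B_wiener : is_wiener B) (u : R).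
Hypothesis u0 : 0 <= u.
Notation c := (normal_second_moment R).
Notation leb := (@lebesgue_measure R).
Notation I := (`[0, u]%classic : set R).

Let mI : measurable I. Proof. by []. Qed.

Lemma wiener_indep_weighted N (t a : nat -> R) : 0 <= t 0%N -> nondecreasing_seq t ->
  mutually_independent P (fun (i : 'I_N) w => a i * (B (t i.+1) w - B (t i) w)).
Proof.
move=> t0 ndt A mA.
pose A' i := ( *%R (a (nat_of_ord i))) @^-1` (A i).
have mA' i : measurable (A' i).
  rewrite -[X in measurable X]setTI.
  exact: (@measurable_funM _ _ R setT (cst (a i)) id).
exact: (wiener_indep B_wiener t0 (fun i => ndt _ _ (leqnSn i)) mA').
Qed.

(** The sum S_N - S_k is the integral of the step function with the first k
    coefficients set to 0, so its second moment is at most that of S_N. *)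
Lemma grid_step_maximal N (t a : nat -> R) (v r : R) : 0 < r ->
  nondecreasing_seq t -> 0 <= t 0%N -> t N <= u ->
  (sqint leb I (step_fun (grid_step t a N)) <= v%:E)%E ->
  (P (\big[setU/set0]_(k < N.+1)
     [set w | (2 * r < `|step_integral (fun t => B t) (grid_step t a k) w|)%R])
   <= (2 * (c * v) / r ^+ 2)%:E)%E.
Proof.
move=> r0 ndt t0 tN hv.
rewrite (eq_bigr (fun k : 'I_N.+1 =>
    [set w | 2 * r < `|\sum_(0 <= i < k) a i * (B (t i.+1) w - B (t i) w)|])); last first.
  by move=> k _; under eq_fun do rewrite step_integral_grid_step.
apply: (@ottaviani _ _ _ P N (fun i w => a i * (B (t i.+1) w - B (t i) w)) _
  (@wiener_indep_weighted N t a t0 ndt) (c * v) r r0).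
  by move=> i; apply: measurable_funM => //; exact: measurable_funB.
move=> k kN.
pose a' i := if (i < k)%N then 0 else a i.
have hu : step_on u (grid_step t a' N) by exact: step_on_grid_step.
have -> : (fun w => \sum_(0 <= i < N) a i * (B (t i.+1) w - B (t i) w) -
    \sum_(0 <= i < k) a i * (B (t i.+1) w - B (t i) w)) =
    step_integral (fun t => B t) (grid_step t a' N).
  apply/funext => w; rewrite step_integral_grid_step.
  rewrite (@big_cat_nat _ _ _ k)//= addrAC subrr add0r.
  rewrite [RHS](@big_cat_nat _ _ _ k)//= [X in _ = X + _]big1_seq ?add0r.
    by apply: eq_big_nat => i /andP[ki _]; rewrite /a' ltnNge ki.
  by move=> i /=; rewrite mem_index_iota => /andP[_ ik]; rewrite /a' ik mul0r.
rewrite /sqint (step_integral_isometry B_wiener hu) EFinM lee_wpmul2l//.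
  by rewrite lee_fin normal_second_moment_ge0.
apply: le_trans hv; apply: le_sqint => //; [exact: measurable_step_fun|exact: measurable_step_fun|].
move=> x _.
have [xin|xout] := boolP (t 0%N < x <= t N); last first.
  by rewrite (step_fun_grid_step a' N x ndt) (negbTE xout) normr0.
have := step_fun_grid_step_in a' ndt xin; move=> [i iN [/andP[ti xti] ->]].
have := step_fun_grid_step_in a ndt xin; move=> [j jN [/andP[tj xtj] ->]].
have -> : i = j.
  apply/eqP; rewrite eqn_leq; apply/andP; split; rewrite leqNgt; apply/negP => /ndt h.
    by have := lt_le_trans ti (le_trans xtj h); rewrite ltxx.
  by have := lt_le_trans tj (le_trans xti h); rewrite ltxx.
by rewrite /a'; case: ifP => // _; rewrite normr0.
Qed.

(** For a fine grid, M at each of the m times is within r of the step integral up to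
    the preceding grid point, except on an event whose probability tends to 0 with
    the mesh; the maximum of the step integrals is handled by Ottaviani's
    inequality. *)
Lemma wiener_integral_maximal (f : R -> R) (M : R -> Omega -> R) (v r : R)
    (m : nat) (s : nat -> R) :
  {within I, continuous f} -> 0 < r ->
  (forall i, 0 <= s i <= u) ->
  (forall x, 0 <= x <= u ->
     wiener_integral B u (fun y => f y * \1_(`]0, x]%classic : set R) y) (M x)) ->
  (sqint leb I f <= v%:E)%E ->
  (P (\big[setU/set0]_(i < m) [set w | (3 * r < `|M (s i) w|)%R]) <=
     (4 * c * v / r ^+ 2)%:E)%E.
Proof.
move=> cf r0 su hM fv; apply/lee_addgt0Pr => e e0.
have c0 := normal_second_moment_ge0 R.
have K0 : 0 < 4 * c * (m%:R + 1) + 1.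
  by rewrite ltr_wpDl// mulr_ge0 ?mulr_ge0// addr_ge0.
pose e' := e * r ^+ 2 / (4 * c * (m%:R + 1) + 1).
have r20 : 0 < r ^+ 2 by rewrite exprn_gt0.
have e'0 : 0 < e' by rewrite /e' divr_gt0// mulr_gt0.
near \oo => N.
have approx : forall k s,
    grid u N k <= s <= grid u N k + u / N.+1%:R -> s <= u ->
    (sqint leb I (fun x => (f x * \1_(`]0, s]%classic : set R) x -
       step_fun (grid_step (grid u N) (f \o grid u N) k) x)%R) <= e'%:E)%E.
  by near: N; exact: sqint_grid_approx.
have ndt := grid_nondecreasing N u0.
have t0 : 0 <= grid u N 0%N by rewrite grid0.
have tk k : (k <= N)%N -> grid u N k <= u.
  by move=> kN; rewrite -[leRHS](grid_last u N); apply: ndt; exact: leqW.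
pose S k := step_integral (fun t => B t) (grid_step (grid u N) (f \o grid u N) k).
have mf1 x : measurable_fun I (fun y => f y * \1_(`]0, x]%classic : set R) y).
  by apply: measurable_funM; [exact: segment_measurable_fun|exact: measurable_indic].
have msf k := @measurable_step_fun R I (grid_step (grid u N) (f \o grid u N) k).
have mS k : measurable_fun setT (S k) by exact: measurable_step_integral.
have mM i : measurable_fun setT (M (s i)) by have [] := hM _ (su i).
have hstep : (sqint leb I (step_fun (grid_step (grid u N) (f \o grid u N) N)) <=
    (2 * e' + 2 * v)%:E)%E.
  have h1 := approx N (grid u N N) _ (tk N (leqnn N)).
  have h2 : (sqint leb I (fun x =>
      (f x * \1_(`]0%R, grid u N N]%classic : set R) x)%R) <= v%:E)%E.
    apply: le_trans fv; apply: le_sqint => //; [exact: mf1|exact: segment_measurable_fun|].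
    by move=> x _; rewrite normrM ler_piMr// indicE; case: (_ \in _); rewrite ?normr1 ?normr0.
  have h3 := @sqint_lincomb _ _ _ leb I mI (-1) _ _ e' v
    (measurable_funB (mf1 _) (msf N)) (mf1 _) (h1 _) h2.
  move: h3; rewrite sqrrN expr1n mulr1 => h3.
  apply: eq_sqint_le (h3 _); first by move=> x _ /=; ring.
  by rewrite lexx lerDl divr_ge0.
have PS := grid_step_maximal r0 ndt t0 (tk N (leqnn N)) hstep.
have kex i : exists k, (k <= N)%N /\
    (P [set w | (r < `|M (s i) w - S k w|)%R] <= (4 * c * e' / r ^+ 2)%:E)%E.
  have [k kN ks] := grid_floor N (su i); exists k; split => //.
  apply: chebyshev_sqint => //; first exact: measurable_funB.
  have /andP[_ siu] := su i.
  have hu : step_on u (grid_step (grid u N) (f \o grid u N) k).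
    exact: step_on_grid_step (tk k kN).
  apply: (wiener_integral_sqint B_wiener
    (wiener_integralB (hM _ (su i)) (step_wiener_integral B hu))).
  exact: approx.
have [k_ hk] := choice kex.
pose E1 := \big[setU/set0]_(k < N.+1) [set w | 2 * r < `|S k w|].
pose E2 := \big[setU/set0]_(i < m) [set w | r < `|M (s i) w - S (k_ i) w|].
have mE1 : measurable E1 by apply: bigsetU_measurable => k _; exact: measurable_gt_normr.
have mE2 : measurable E2.
  by apply: bigsetU_measurable => k _; apply: measurable_gt_normr; exact: measurable_funB.
apply: (@le_trans _ _ (P (E1 `|` E2))).
  apply: le_measure; rewrite ?inE.
  - by apply: bigsetU_measurable => i _; exact: measurable_gt_normr.
  - exact: measurableU.
  rewrite -(bigcup_mkord _ (fun i => [set w | 3 * r < `|M (s i) w|])) => w [i /= im wi].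
  have [h|h] := leP `|M (s i) w - S (k_ i) w| r; last first.
    right; rewrite /E2.
    by rewrite -(bigcup_mkord _ (fun i => [set w | r < `|M (s i) w - S (k_ i) w|])); exists i.
  left; rewrite /E1 -(bigcup_mkord _ (fun k => [set w | 2 * r < `|S k w|])).
  exists (k_ i) => /=; first by have [] := hk i.
  have := ler_normD (S (k_ i) w) (M (s i) w - S (k_ i) w).
  rewrite addrC subrK; lra.
apply: (le_trans (measureU2 _ mE1 mE2)).
have PE2 : (P E2 <= (m%:R * (4 * c * e' / r ^+ 2))%:E)%E.
  apply: (le_trans (@Boole_inequality _ _ _ P
    (fun i => [set w | r < `|M (s i) w - S (k_ i) w|]) m _)).
    by move=> i _; apply: measurable_gt_normr; exact: measurable_funB.
  apply: (@le_trans _ _ (\sum_(i < m) (4 * c * e' / r ^+ 2)%:E)%E).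
    by apply: lee_sum => i _; have [] := hk i.
  by rewrite sumEFin lee_fin sumr_const card_ord [leRHS]mulr_natl.
apply: (le_trans (leeD PS PE2)).
rewrite -!EFinD lee_fin.
have -> : 2 * (c * (2 * e' + 2 * v)) / r ^+ 2 + m%:R * (4 * c * e' / r ^+ 2) =
  4 * c * v / r ^+ 2 + 4 * c * (m%:R + 1) * e' / r ^+ 2 by field; rewrite gt_eqF.
rewrite lerD2l ler_pdivrMr//.
have -> : e * r ^+ 2 = (4 * c * (m%:R + 1) + 1) * e'.
  by rewrite /e'; field; rewrite gt_eqF.
by rewrite ler_wpM2r ?(ltW e'0)// lerDl.
Unshelve. all: by end_near. Qed.

End maximal.

(** * Functions of class C1 relative to a set *)

Section C1_functions.
Context (R : realType).
Notation leb := (@lebesgue_measure R).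
Implicit Types (D : set R) (f g : R -> R).

Lemma is_C1_on_continuous D f f' : is_C1_on D f f' -> {within D, continuous f}.
Proof.
move=> [df _]; apply/subspace_continuousP => x Dx.
apply/cvgrPdist_le => e e0.
have K0 : 0 < `|f' x| + 1 by rewrite ltr_wpDl.
have /cvgrPdist_le/(_ 1 ltr01) := df x Dx.
move=> dfx.
have h : nbhs x (fun y => y != x -> D y -> `|f' x - (f y - f x) / (y - x)| <= 1) := dfx.
change (nbhs x (fun y => D y -> `|f x - f y| <= e)).
near=> y => Dy.
have [->|yx] := eqVneq y x; first by rewrite subrr normr0 ltW.
have q : `|f' x - (f y - f x) / (y - x)| <= 1.
  by move: yx Dy; near: y; exact: h.
have yx0 : y - x != 0 by rewrite subr_eq0.
have -> : f x - f y = - ((f y - f x) / (y - x)) * (y - x) by field.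
rewrite normrM normrN.
have q' : `|(f y - f x) / (y - x)| <= `|f' x| + 1.
  have -> : (f y - f x) / (y - x) = f' x - (f' x - (f y - f x) / (y - x)) by ring.
  by rewrite (le_trans (ler_normB _ _))// lerD2l.
have xy : `|y - x| <= e / (`|f' x| + 1).
  rewrite distrC; near: y.
  have : id y @[y --> x] --> x by exact: cvg_id.
  by move=> /cvgrPdist_le; apply; rewrite divr_gt0.
apply: (le_trans (ler_pM _ _ q' xy)) => //.
by rewrite mulrC divfK// gt_eqF.
Unshelve. all: by end_near. Qed.

Lemma is_C1_on_inv D f f' : (forall x, D x -> f x != 0) -> is_C1_on D f f' ->
  is_C1_on D (fun x => (f x)^-1) (fun x => - f' x / f x ^+ 2).
Proof.
move=> f0 fC1; have /subspace_continuousP cf := is_C1_on_continuous fC1.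
case: fC1 => df /subspace_continuousP cf'.
split; last first.
  apply/subspace_continuousP => x Dx.
  apply: cvgM; first by apply: cvgN; exact: cf'.
  apply: cvgV; first by rewrite expf_neq0// f0.
  exact: (cvg_comp _ _ (cf x Dx) (@exprn_continuous _ 2 (f x))).
move=> x Dx.
have cfx' : f y @[y --> within D x^'] --> f x.
  apply: cvg_trans (cf x Dx) => A.
  change (nbhs x (fun y => D y -> A (f y)) -> nbhs x (fun y => y != x -> D y -> A (f y))).
  by apply: filterS => y h _; exact: h.
have -> : - f' x / f x ^+ 2 = - f' x * ((f x)^-1 * (f x)^-1).
  by rewrite expr2 invfM.
have : - ((f y - f x) / (y - x)) * ((f y)^-1 * (f x)^-1) @[y --> within D x^']
    --> - f' x * ((f x)^-1 * (f x)^-1).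
  apply: cvgM; first by apply: cvgN; exact: df.
  apply: cvgM; last exact: cvg_cst.
  by apply: cvgV => //; exact: f0.
apply: cvg_trans; apply: near_eq_cvg.
change (nbhs x (fun y => y != x -> D y ->
  - ((f y - f x) / (y - x)) * ((f y)^-1 * (f x)^-1) = ((f y)^-1 - (f x)^-1) / (y - x))).
apply/nbhs_ballP; exists 1 => //= y _ yx Dy.
have yx0 : y - x != 0 by rewrite subr_eq0.
have := f0 y Dy; have := f0 x Dx => fx0 fy0.
by field; rewrite fx0 fy0 yx0.
Qed.

Lemma segment_integrable f (a b : R) : {within `[a, b], continuous f} ->
  leb.-integrable `[a, b] (EFin \o f).
Proof.
by move=> cf; apply: continuous_compact_integrable => //; exact: segment_compact.
Qed.

(** Relative derivatives are ordinary ones inside D, and relative continuity at the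
    end points is all that the fundamental theorem asks for there. *)
Lemma is_C1_on_FTC D f f' (a b : R) : `[a, b]%classic `<=` D -> is_C1_on D f f' ->
  a <= b -> \int[leb]_(x in `[a, b]) f' x = f b - f a.
Proof.
move=> abD fC1; rewrite le_eqVlt => /predU1P[<-|ab].
  by rewrite set_itv1 Rintegral_set1 subrr.
have cf : {within `[a, b], continuous f}.
  exact: continuous_subspaceW abD (is_C1_on_continuous fC1).
have cf' : {within `[a, b], continuous f'} by exact: continuous_subspaceW abD fC1.2.
have dfx : forall x, x \in `]a, b[ -> is_derive x 1 f (f' x).
  move=> x xab.
  have Dx : D x by apply: abD; exact: subset_itv_oo_cc xab.
  have nD : nbhs x D.
    apply: (@filterS _ (nbhs x) _ `]a, b[%classic).
      by move=> y /subset_itv_oo_cc/abD.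
    by apply: near_in_itvoo.
  have q : (f (h + x) - f x) / h @[h --> 0^'] --> f' x.
    apply/cvgrPdist_le => e e0.
    have /cvgrPdist_le/(_ e e0) := fC1.1 x Dx.
    move=> dq.
    have hq : nbhs x (fun y =>
      y != x -> D y -> `|f' x - (f y - f x) / (y - x)| <= e) := dq.
    have hqD : nbhs x ((fun y => y != x -> D y -> `|f' x - (f y - f x) / (y - x)| <= e) `&` D).
      exact: filterI.
    have /nbhs_ballP[r /= r0 hr] := hqD.
    change (nbhs (0 : R) (fun h => h != 0 -> `|f' x - (f (h + x) - f x) / h| <= e)).
    apply/nbhs_ballP; exists r => //= h; rewrite /ball/= sub0r normrN => hr' h0.
    have [] := hr (h + x); first by rewrite /ball/= opprD addrCA subrr addr0 normrN.
    by rewrite addrK -subr_eq0 addrK; exact.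
  have q' : h^-1 *: (f (h *: 1 + x) - f x) @[h --> 0^'] --> f' x.
    apply: cvg_trans q; apply: near_eq_cvg; apply: nearW => h /=.
    by rewrite /GRing.scale/= mulr1 mulrC.
  apply: DeriveDef; first by apply/cvg_ex; exists (f' x).
  exact: cvg_lim q'.
rewrite /Rintegral (@continuous_FTC2 _ f' f)//.
- have [_ cfa cfb] := (continuous_within_itvP f ab).1 cf.
  by split => // x xab; have [] := dfx x xab.
- by move=> x xab; rewrite derive1E; have [_ ->] := dfx x xab.
Qed.

End C1_functions.

(** * Pathwise limits of weighted increments *)

Section pathwise_sums.
Context (R : realType).
Notation leb := (@lebesgue_measure R).

Lemma within_continuousM (A : set R) (f g : R -> R) : {within A, continuous f} ->
  {within A, continuous g} -> {within A, continuous (fun x => f x * g x)}.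
Proof. by move=> cf cg x; apply: cvgM; [exact: cf|exact: cg]. Qed.

Lemma within_continuousD (A : set R) (f g : R -> R) : {within A, continuous f} ->
  {within A, continuous g} -> {within A, continuous (fun x => f x + g x)}.
Proof. by move=> cf cg x; apply: cvgD; [exact: cf|exact: cg]. Qed.

Lemma within_continuousB (A : set R) (f g : R -> R) : {within A, continuous f} ->
  {within A, continuous g} -> {within A, continuous (fun x => f x - g x)}.
Proof. by move=> cf cg x; apply: cvgB; [exact: cf|exact: cg]. Qed.

Lemma within_continuous_cst (A : set R) (r : R) : {within A, continuous (fun=> r)}.
Proof. by move=> x; exact: cvg_cst. Qed.

Lemma within_continuous_norm (A : set R) (f : R -> R) : {within A, continuous f} ->
  {within A, continuous (fun x => `|f x|)}.
Proof. by move=> cf x; apply: continuous_comp; [exact: cf|exact: norm_continuous]. Qed.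

Variables (s : R) (g dg z v : R -> R).
Notation I := (`[0, s]%classic : set R).
Hypotheses (s0 : 0 <= s) (cg : {within I, continuous g})
  (cdg : {within I, continuous dg}) (cz : {within I, continuous z})
  (cv : {within I, continuous v}).
Hypothesis g_FTC : forall x y, 0 <= x -> x <= y -> y <= s ->
  \int[leb]_(r in `[x, y]) dg r = g y - g x.

Lemma Rintegral_segmentB (f : R -> R) x y : {within I, continuous f} ->
  0 <= x -> x <= y -> y <= s ->
  \int[leb]_(r in `[0, y]) f r - \int[leb]_(r in `[0, x]) f r =
  \int[leb]_(r in `[x, y]) f r.
Proof.
move=> cf x0 xy ys; have intf := segment_integrable cf.
rewrite Rintegral_itvB ?bnd_simp//; last first.
  by apply: integrableS intf => // r /=; rewrite !in_itv/= => /andP[-> /le_trans->].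
rewrite Rintegral_itv_obnd_cbnd//.
apply: integrableS intf => // r /=; rewrite !in_itv/= => /andP[/ltW/(le_trans x0) -> /le_trans->]//.
Qed.

Let k r := dg r * z r + g r * v r.
Let ck : {within I, continuous k}.
Proof. by apply: within_continuousD; exact: within_continuousM. Qed.
Let Phi t := g t * z t - \int[leb]_(r in `[0, t]) k r.

(** With k = dg z + g v and Phi = g z - \int k, the difference equals
    \int_x^y ((z r - z y) dg r + (g r - g x) v r) dr: both factors in parentheses
    are small when x and y are close. *)
Lemma local_increment (e : R) : 0 < e -> exists2 dl : R, 0 < dl &
  forall x y, 0 <= x -> x <= y -> y <= s -> y - x <= dl ->
  `|g x * (z y - z x - \int[leb]_(r in `[x, y]) v r) - (Phi y - Phi x)| <= e * (y - x).
Proof.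
move=> e0.
have [F1 F10 dgF] := segment_bounded cdg.
have [F2 F20 vF] := segment_bounded cv.
have K0 : 0 < F1 + F2 + 1 by rewrite ltr_wpDl// addr_ge0.
have e'0 : 0 < e / (F1 + F2 + 1) by rewrite divr_gt0.
have [d1 d10 zd] := segment_uniform_continuity cz e'0.
have [d2 d20 gd] := segment_uniform_continuity cg e'0.
exists (Num.min d1 d2); first by rewrite lt_min d10.
move=> x y x0 xy ys; rewrite le_min => /andP[yx1 yx2].
have sub : `[x, y]%classic `<=` I.
  by move=> r /=; rewrite !in_itv/= => /andP[/(le_trans x0)-> /le_trans->].
have ints f : {within I, continuous f} -> leb.-integrable `[x, y] (EFin \o f).
  by move=> cf; apply: integrableS (segment_integrable cf).
have -> : g x * (z y - z x - \int[leb]_(r in `[x, y]) v r) - (Phi y - Phi x) =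
    \int[leb]_(r in `[x, y]) ((z r - z y) * dg r + (g r - g x) * v r).
  have -> : Phi y - Phi x = g y * z y - g x * z x - \int[leb]_(r in `[x, y]) k r.
    rewrite -(Rintegral_segmentB ck x0 xy ys) /Phi; ring.
  have -> : \int[leb]_(r in `[x, y]) ((z r - z y) * dg r + (g r - g x) * v r) =
     \int[leb]_(r in `[x, y]) (k r - (z y * dg r + g x * v r)).
    by apply: eq_Rintegral => r _; rewrite /k; ring.
  rewrite RintegralB//; last 2 first.
  - exact: ints.
  - apply: (@ints (fun r => _)); apply: within_continuousD;
      by apply: within_continuousM => //; exact: within_continuous_cst.
  rewrite (@RintegralD _ _ _ leb `[x, y]
    (fun r => z y * dg r) (fun r => g x * v r))//; last 2 first.
  - by apply: (@ints (fun r => _)); apply: within_continuousM => //; exact: within_continuous_cst.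
  - by apply: (@ints (fun r => _)); apply: within_continuousM => //; exact: within_continuous_cst.
  rewrite (@RintegralZl _ _ _ leb `[x, y] dg (z y))//; last exact: ints.
  rewrite (@RintegralZl _ _ _ leb `[x, y] v (g x))//; last exact: ints.
  by rewrite g_FTC//; ring.
have cw : {within I, continuous (fun r => (z r - z y) * dg r + (g r - g x) * v r)}.
  apply: within_continuousD; apply: within_continuousM => //;
  by apply: within_continuousB => //; exact: within_continuous_cst.
apply: (le_trans (le_normr_Rintegral _ (ints _ cw))) => //.
have -> : e * (y - x) = \int[leb]_(r in `[x, y]) e.
  rewrite Rintegral_cst//= lebesgue_measure_itv/= lte_fin; case: ltP => //= yx.
  by have -> : x = y by [apply/eqP; rewrite eq_le xy]; rewrite subrr.
apply: le_Rintegral => //.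
- apply: (@ints (fun r => `|(z r - z y) * dg r + (g r - g x) * v r|)).
  exact: within_continuous_norm.
- by apply: (@ints (fun r => e)); exact: within_continuous_cst.
move=> r /= rxy.
have rI := sub r rxy; have xI : x \in `[0, s] by rewrite in_itv/= x0 (le_trans xy).
have yI : y \in `[0, s] by rewrite in_itv/= ys (le_trans x0).
move: rxy; rewrite in_itv/= => /andP[xr ry].
have h1 : `|z r - z y| <= e / (F1 + F2 + 1).
  by apply: zd => //; rewrite ler0_norm ?subr_le0//; lra.
have h2 : `|g r - g x| <= e / (F1 + F2 + 1).
  by apply: gd => //; rewrite ger0_norm ?subr_ge0//; lra.
apply: (le_trans (ler_normD _ _)); rewrite !normrM.
apply: (@le_trans _ _ (e / (F1 + F2 + 1) * F1 + e / (F1 + F2 + 1) * F2)).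
  by apply: lerD; apply: ler_pM => //; [exact: dgF|exact: vF].
rewrite -mulrDr -mulrA ler_piMr ?(ltW e0)// mulrC ler_pdivrMr// mul1r lerDl//.
Qed.

(** Integration by parts along a path: if z - \int v is the path of a noise J, the
    sums of g(t_i) (J_{t_(i+1)} - J_{t_i}) converge to g z - \int (dg z + g v),
    although J need not have bounded variation. *)
Lemma pathwise_sum_cvg :
  \sum_(0 <= i < N.+1) g (grid s N i) *
     (z (grid s N i.+1) - z (grid s N i) -
       \int[leb]_(r in `[grid s N i, grid s N i.+1]) v r) @[N --> \oo]
  --> g s * z s - g 0 * z 0 - \int[leb]_(r in `[0, s]) (dg r * z r + g r * v r).
Proof.
apply/cvgrPdist_le => e e0.
have e'0 : 0 < e / (s + 1) by rewrite divr_gt0// ltr_wpDl.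
have [dl dl0 loc] := local_increment e'0.
near=> N.
have ndt := grid_nondecreasing N s0.
have mesh : s / N.+1%:R <= dl by near: N; exact: grid_mesh.
have -> : g s * z s - g 0 * z 0 - \int[leb]_(r in `[0, s]) (dg r * z r + g r * v r) =
    \sum_(0 <= i < N.+1) (Phi (grid s N i.+1) - Phi (grid s N i)).
  rewrite telescope_sumr// grid_last grid0 /Phi set_itv1 Rintegral_set1 subr0.
  by rewrite addrAC.
rewrite -sumrB (le_trans (ler_norm_sum _ _ _))//.
apply: (@le_trans _ _ (\sum_(0 <= i < N.+1) e / (s + 1) * (grid s N i.+1 - grid s N i))).
  rewrite !big_nat; apply: ler_sum => i /andP[_ iN].
  rewrite distrC; apply: loc.
  - by rewrite -(grid0 s N); exact: ndt.
  - exact: ndt.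
  - by rewrite -[leRHS](grid_last s N); exact: ndt.
  - by rewrite gridS addrAC subrr add0r.
rewrite -big_distrr/= telescope_sumr// grid_last grid0 subr0.
by rewrite mulrAC ler_pdivrMr ?ltr_wpDl// ler_wpM2l ?(ltW e0)// lerDl.
Unshelve. all: by end_near. Qed.

End pathwise_sums.

(** * Ito integrals of deterministic integrands *)

Section ito_integrals.
Context d (Omega : measurableType d) (R : realType) (P : probability Omega R).
Variables (B : R -> {RV P >-> R}) (B_wiener : is_wiener B).
Notation c := (normal_second_moment R).
Notation leb := (@lebesgue_measure R).

Lemma step_fun_out (s x : R) h : step_on s h -> ~~ (0 < x <= s) -> step_fun h x = 0.
Proof.
move=> hs xs; rewrite /step_fun big_seq big1// => i /hs[a0 _ bs].
rewrite indicE memNset ?mulr0//= in_itv/= => /andP[ax xb].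
by move: xs; rewrite (le_lt_trans a0 ax) (le_trans xb bs).
Qed.

(** Extending an integrand by 0 beyond s does not change the integral; this allows
    integrals at different times to be compared over one interval. *)
Lemma wiener_integral_widen (s u : R) (f : R -> R) (X : Omega -> R) :
  s <= u -> wiener_integral B s f X ->
  wiener_integral B u (fun x => f x * \1_(`]0, s]%classic : set R) x) X.
Proof.
move=> su [mf mX ap].
have mf1 : measurable_fun (`[0, u]%classic : set R) (fun x => f x * \1_(`]0, s]%classic : set R) x).
  have -> : (fun x => f x * \1_(`]0, s]%classic : set R) x) = f \_ `]0, s].
    by apply/funext => x; rewrite patchE indicE; case: ifP; rewrite ?mulr1 ?mulr0.
  apply/measurable_restrict => //.
  by apply: measurable_funS mf => // x [_] /=; rewrite !in_itv/= => /andP[/ltW-> ->].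
split => // e e0; have [h [hs hf hX]] := ap e e0; exists h; split => //.
  by move=> i /hs[? ? /le_trans->].
apply: le_trans hf; rewrite /sqint.
have -> : `[0, s]%classic = `[0, u]%classic `&` `[0, s]%classic :> set R.
  by rewrite setIidr// => x /=; rewrite !in_itv/= => /andP[-> /le_trans->].
rewrite [leRHS]integral_mkcondr; apply: ge0_le_integral => //.
- by move=> x _; rewrite lee_fin sqr_ge0.
- apply/measurable_EFinP/measurable_funX/measurable_funB => //; exact: measurable_step_fun.
- apply/measurable_restrict => //; apply/measurable_EFinP/measurable_funX/measurable_funB.
    exact: measurable_step_fun.
  by apply: measurable_funS mf => // x [].
move=> x _; rewrite patchE.
have [xin|xout] := boolP (0 < x <= s).
  rewrite mem_set /=; last by rewrite in_itv/=; case/andP: xin => /ltW-> ->.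
  by rewrite indicE mem_set ?mulr1//= in_itv.
rewrite (step_fun_out hs xout) indicE memNset ?mulr0 ?subrr ?expr0n//=; last first.
  by rewrite in_itv; exact/negP.
by case: ifP => // _; rewrite lee_fin sqr_ge0.
Qed.

Lemma cvge0_le (x : nat -> \bar R) (e : R) : 0 < e -> x @ \oo --> 0%E ->
  \forall n \near \oo, (x n <= e%:E)%E.
Proof.
move=> e0 /fine_cvgP[fx /cvgrPdist_le/(_ e e0)].
apply: filterS2 fx => n fx; rewrite sub0r normrN => h.
by rewrite -(fineK fx) lee_fin (le_trans (ler_norm _)).
Qed.

Lemma ito_wiener_integral (T : \bar R) (f : R -> R) (J : R -> Omega -> R) (s : R) :
  is_ito_integral B T f J -> horizon T s -> measurable_fun (`[0, s]%classic : set R) f ->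
  wiener_integral B s f (J s).
Proof.
move=> [mJ _ L2] Ts mf; split => //; first exact: mJ.
move=> e e0; have [h [hs hf hJ]] := L2 s Ts.
have nf := cvge0_le e0 hf.
have nJ : \forall n \near \oo,
    (sqint P setT (fun w => (step_integral (fun t => B t) (h n) w - J s w)%R) <= e%:E)%E.
  by have := cvge0_le e0 hJ; rewrite unlock.
near \oo => n; exists (h n); split; [exact: hs|by near: n|by near: n].
Unshelve. all: by end_near. Qed.

Lemma ito_integral0 (T : \bar R) (f : R -> R) (J : R -> Omega -> R) :
  is_ito_integral B T f J -> horizon T 0 -> {ae P, forall w, J 0 w = 0}.
Proof.
move=> itoJ T0.
have h : wiener_integral B 0 f (J 0).
  apply: ito_wiener_integral itoJ T0 _.
  by rewrite set_itv1; exact: measurable_fun_set1.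
have f0 : (sqint leb (`[0%R, 0%R]%classic : set R) f <= 0%:E)%E.
  by rewrite /sqint set_itv1 integral_set1.
have := wiener_integral_sqint B_wiener h f0; rewrite mulr0 => J0.
have mJ0 := wiener_integral_measurable h.
have : (\int[P]_w `|(J 0%R w ^+ 2)%:E| = 0)%E.
  apply/eqP; rewrite eq_le; apply/andP; split; last exact: integral_ge0.
  apply: le_trans J0; rewrite le_eqVlt; apply/predU1P; left.
  by apply: eq_integral => w _; rewrite gee0_abs// lee_fin sqr_ge0.
have m2 : measurable_fun setT (fun w => (J 0 w ^+ 2)%:E).
  exact/measurable_EFinP/measurable_funX.
move=> /(ae_eq_integral_abs P measurableT m2).1; apply: filterS => w /(_ I).
by move=> /= /eqP; rewrite eqe sqrf_eq0 => /eqP.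
Qed.

End ito_integrals.

(** * The normalized solution *)

(** An integral from a to b is a difference of two integrals from 0. *)
Lemma indicB_oc (R : realType) (a b x : R) : 0 <= a -> a <= b ->
  \1_(`]a, b]%classic : set R) x =
  \1_(`]0, b]%classic : set R) x - \1_(`]0, a]%classic : set R) x :> R.
Proof.
move=> a0 ab; rewrite !indicE !mem_setE !in_itv/=.
have [x0|x0] := leP x 0.
  by rewrite ltNge (le_trans x0 a0)/= subrr.
have [xa|ax] := leP x a; first by rewrite (le_trans xa ab)/= subrr.
by rewrite subr0.
Qed.

Section solution.
Context (R : realType) (T : \bar R) (phi dphi psi sigma : R -> R).
Context d (Omega : measurableType d) (P : probability Omega R).
Variables (B : R -> {RV P >-> R}) (xi : R) (Z : R -> Omega -> R).
Hypotheses (T_gt0 : (0 < T)%E) (phi_gt0 : forall t, horizon T t -> 0 < phi t)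
  (phi_C1 : is_C1_on (horizon T) phi dphi) (phi0 : phi 0 = 1)
  (psi_cont : {within horizon T, continuous psi})
  (sigma_cont : {within horizon T, continuous sigma})
  (B_wiener : is_wiener B)
  (Z_sol : is_strong_solution B T (fun t => dphi t / phi t) psi sigma xi Z).
Notation leb := (@lebesgue_measure R).

Lemma horizon_le (s t : R) : 0 <= t -> t <= s -> horizon T s -> horizon T t.
Proof. by move=> t0 ts [_ sT]; split => //; apply: le_lt_trans sT; rewrite lee_fin. Qed.

Lemma segment_horizon (s : R) : horizon T s -> `[0, s]%classic `<=` horizon T.
Proof. by move=> Ts x /=; rewrite in_itv/= => /andP[x0 xs]; exact: horizon_le xs Ts. Qed.

Lemma horizon0 : horizon T 0.
Proof. by split. Qed.

Let phi_neq0 t : horizon T t -> phi t != 0.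
Proof. by move=> /phi_gt0; rewrite lt0r => /andP[]. Qed.

Let g t := (phi t)^-1.
Let dg t := - dphi t / phi t ^+ 2.
Let g_C1 : is_C1_on (horizon T) g dg.
Proof. exact: is_C1_on_inv. Qed.

(** Defined from Z rather than as a stochastic integral, it is measurable at each
    time and has continuous paths because Z does. *)
Definition normalized_solution (t : R) (w : Omega) : R :=
  Z t w / phi t - xi - \int[leb]_(s in `[0, t]) (psi s / phi s).

Lemma normalized_solution_measurable t : horizon T t ->
  measurable_fun setT (normalized_solution t).
Proof.
move=> Tt; apply: measurable_funB => //; apply: measurable_funB => //.
by apply: measurable_funM => //; exact: (solution_measurable Z_sol Tt).
Qed.

(** The equation for Z identifies J with Z - xi - \int v for the drift
    v = (phi' / phi) Z + psi; for g = 1 / phi the integrand g' Z + g v of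
    [pathwise_sum_cvg] reduces to psi / phi. *)
Lemma noise_increment_sum_cvg (J : R -> Omega -> R) (s : R) :
  is_ito_integral B T sigma J -> horizon T s ->
  {ae P, forall w, forall t, horizon T t ->
        Z t w = xi + \int[leb]_(s in `[0, t])
                       ((fun t => dphi t / phi t) s * Z s w + psi s)
                   + J t w} ->
  {ae P, forall w,
    \sum_(i < N.+1) g (grid s N i) * (J (grid s N i.+1) w - J (grid s N i) w)
      @[N --> \oo] --> normalized_solution s w}.
Proof.
move=> itoJ Ts Zeq.
have subI := segment_horizon Ts.
have s0 : 0 <= s by case: Ts.
have J0 := ito_integral0 B_wiener itoJ horizon0.
have cg : {within `[0, s]%classic, continuous g} :=
  continuous_subspaceW subI (is_C1_on_continuous g_C1).
have cdg : {within `[0, s]%classic, continuous dg} := continuous_subspaceW subI g_C1.2.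
have cdphi : {within `[0, s]%classic, continuous dphi} := continuous_subspaceW subI phi_C1.2.
have cpsi : {within `[0, s]%classic, continuous psi} := continuous_subspaceW subI psi_cont.
have g_FTC x y : 0 <= x -> x <= y -> y <= s -> \int[leb]_(r in `[x, y]) dg r = g y - g x.
  move=> x0 xy ys; apply: (is_C1_on_FTC _ g_C1) => // r /=.
  rewrite in_itv/= => /andP[xr ry]; apply: horizon_le Ts; first exact: le_trans xr.
  exact: le_trans ys.
apply: filterS3 J0 Zeq (solution_cont Z_sol) => w J0 Zeq cZw.
pose z t := Z t w; pose v t := dphi t / phi t * z t + psi t.
have cz : {within `[0, s]%classic, continuous z} := continuous_subspaceW subI cZw.
have cv : {within `[0, s]%classic, continuous v}.
  apply: within_continuousD => //; apply: within_continuousM => //.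
  exact: within_continuousM.
have z0 : z 0 = xi.
  by rewrite /z (Zeq 0 horizon0) J0 set_itv1 Rintegral_set1 !addr0.
have := pathwise_sum_cvg s0 cg cdg cz cv g_FTC.
have -> : g s * z s - g 0 * z 0 - \int[leb]_(r in `[0, s]) (dg r * z r + g r * v r) =
    normalized_solution s w.
  rewrite /normalized_solution z0 /g phi0 invr1 mul1r mulrC; congr (_ - _).
  apply: eq_Rintegral => r; rewrite inE => /subI/phi_neq0 phir.
  by rewrite /dg /v; field.
apply: cvg_trans; apply: near_eq_cvg; apply: nearW => N.
rewrite big_mkord; apply: eq_bigr => i _; congr (_ * _).
have ndt := grid_nondecreasing N s0.
have ti0 : 0 <= grid s N i by rewrite -(grid0 s N); exact: ndt.
have tiS : grid s N i <= grid s N i.+1 by exact: ndt.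
have tis : grid s N i.+1 <= s by rewrite -[leRHS](grid_last s N); exact: ndt.
rewrite -(Rintegral_segmentB cv ti0 tiS tis) /z.
rewrite (Zeq (grid s N i.+1)); last by apply: horizon_le tis Ts; exact: le_trans tiS.
rewrite (Zeq (grid s N i)); last by apply: horizon_le Ts => //; exact: le_trans tis.
rewrite /v /z; ring.
Qed.

(** The sums of [noise_increment_sum_cvg] are integrals of sigma times a step
    function that tends to 1 / phi in L^2. *)
Lemma normalized_solution_wiener_integral (s u : R) : horizon T u ->
  0 <= s -> s <= u ->
  wiener_integral B u (fun x => sigma x / phi x * \1_(`]0, s]%classic : set R) x)
    (normalized_solution s).
Proof.
move=> Tu s0 su; have Ts := horizon_le s0 su Tu.
have subI := segment_horizon Ts.
have [J itoJ Zeq] := solution_eq Z_sol.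
have cg : {within `[0, s]%classic, continuous g} :=
  continuous_subspaceW subI (is_C1_on_continuous g_C1).
have csigma : {within `[0, s]%classic, continuous sigma} := continuous_subspaceW subI sigma_cont.
have mf : measurable_fun (`[0, s]%classic : set R) (fun x => sigma x / phi x).
  by apply: segment_measurable_fun; exact: within_continuousM.
suff h : wiener_integral B s (fun x => sigma x / phi x * \1_(`]0, s]%classic : set R) x)
    (normalized_solution s).
  have := wiener_integral_widen su h; apply: wiener_integral_eq => x _.
  by rewrite -mulrA; congr (_ * _); rewrite indicE; case: (_ \in _); rewrite ?mulr1 ?mulr0.
have tN N i : (i <= N.+1)%N -> 0 <= grid s N i <= s.
  move=> iN; have ndt := grid_nondecreasing N s0.
  by rewrite -{1}(grid0 s N) -{4}(grid_last s N) !ndt.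
have pairJ t : 0 <= t <= s ->
    wiener_integral B s (fun x => sigma x * \1_(`]0, t]%classic : set R) x) (J t).
  move=> /andP[t0 ts]; apply: wiener_integral_widen => //.
  apply: (ito_wiener_integral itoJ); first exact: horizon_le ts Ts.
  apply: segment_measurable_fun; apply: continuous_subspaceW csigma => x /=.
  by rewrite !in_itv/= => /andP[-> /le_trans->].
apply: (@wiener_integral_lim _ _ _ _ _ B_wiener s
  (fun N x => \sum_(i < N.+1) g (grid s N i) *
     (sigma x * \1_(`]0, grid s N i.+1]%classic : set R) x -
      sigma x * \1_(`]0, grid s N i]%classic : set R) x))
  (fun N w => \sum_(i < N.+1) g (grid s N i) * (J (grid s N i.+1) w - J (grid s N i) w))).
- move=> N; apply: (@wiener_integral_sum _ _ _ _ _ _ 'I_N.+1) => i.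
  by apply: wiener_integralB; apply: pairJ; apply: tN => //; exact: ltnW.
- by apply: measurable_funM => //; exact: measurable_indic.
- exact: normalized_solution_measurable.
- move=> e e0.
  have [F F0 sF] := segment_bounded csigma.
  have F1 : 0 < 2 * F ^+ 2 + 1 by have := sqr_ge0 F; lra.
  have e'0 : 0 < e / (2 * F ^+ 2 + 1) by rewrite divr_gt0.
  have := sqint_grid_approx s0 cg e'0; apply: filterS => N.
  move=> /(_ N.+1 s).
  rewrite grid_last lexx lerDl divr_ge0//= => /(_ isT isT) hN.
  have mq : measurable_fun (`[0, s]%classic : set R)
      (fun x => g x * \1_(`]0, s]%classic : set R) x -
     step_fun (grid_step (grid s N) (g \o grid s N) N.+1) x).
    apply: measurable_funB; last exact: measurable_step_fun.
    by apply: measurable_funM; [exact: segment_measurable_fun|exact: measurable_indic].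
  have zero : (sqint leb (`[0%R, s]%classic : set R) (fun=> 0%R) <= 0%:E)%E.
    by rewrite /sqint; under eq_integral do rewrite expr0n/=; rewrite integral0.
  have m0 : measurable_fun (`[0, s]%classic : set R) (fun _ : R => 0 : R) by [].
  have := @sqint_lincomb _ _ _ leb `[0, s]%classic (measurable_itv _) F _ _ _ 0 mq m0 hN zero.
  rewrite mulr0 addr0 => le2.
  apply: (@le_trans _ _ (2 * F ^+ 2 * (e / (2 * F ^+ 2 + 1)))%:E); last first.
    by rewrite lee_fin mulrCA ler_piMr ?(ltW e0)// ler_pdivrMr// mul1r lerDl.
  apply: le_trans le2; apply: le_sqint => //.
  - apply: measurable_funB; last by apply: measurable_funM => //; exact: measurable_indic.
    apply: measurable_sum => i; apply: measurable_funM => //; apply: measurable_funB;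
      by apply: measurable_funM; [exact: segment_measurable_fun|exact: measurable_indic].
  - by apply: measurable_funD => //; exact: measurable_funM.
  move=> x xI; rewrite addr0.
  have ndt := grid_nondecreasing N s0.
  have -> : \sum_(i < N.+1) g (grid s N i) *
     (sigma x * \1_(`]0, grid s N i.+1]%classic : set R) x -
      sigma x * \1_(`]0, grid s N i]%classic : set R) x) =
     sigma x * step_fun (grid_step (grid s N) (g \o grid s N) N.+1) x.
    rewrite /step_fun big_map big_distrr.
    rewrite -[iota 0 N.+1]/(index_iota 0 N.+1) big_mkord.
    apply: eq_bigr => i _.
    have ti0 : 0 <= grid s N i by rewrite -(grid0 s N); exact: ndt.
    have tiS : grid s N i <= grid s N i.+1 by exact: ndt.
    rewrite /= (@indicB_oc R (grid s N i) (grid s N i.+1))//; ring.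
  have -> : sigma x * step_fun (grid_step (grid s N) (g \o grid s N) N.+1) x -
    sigma x / phi x * \1_(`]0, s]%classic : set R) x = - (sigma x *
     (g x * \1_(`]0, s]%classic : set R) x -
      step_fun (grid_step (grid s N) (g \o grid s N) N.+1) x)).
    by rewrite /g; ring.
  by rewrite normrN !normrM ler_wpM2r// (ger0_norm F0) sF.
- exact: noise_increment_sum_cvg.
Qed.

End solution.

(** * Tail events at bounded variance *)

Section tail_bound.
Context (R : realType) (T : \bar R) (phi dphi psi sigma : R -> R).
Context d (Omega : measurableType d) (P : probability Omega R).
Variables (B : R -> {RV P >-> R}) (xi : R) (Z : R -> Omega -> R).
Hypotheses (T_gt0 : (0 < T)%E) (phi_gt0 : forall t, horizon T t -> 0 < phi t)
  (phi_C1 : is_C1_on (horizon T) phi dphi) (phi0 : phi 0 = 1)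
  (psi_cont : {within horizon T, continuous psi})
  (sigma_cont : {within horizon T, continuous sigma})
  (B_wiener : is_wiener B)
  (Z_sol : is_strong_solution B T (fun t => dphi t / phi t) psi sigma xi Z).
Notation leb := (@lebesgue_measure R).
Notation c := (normal_second_moment R).
Notation M := (normalized_solution phi psi xi Z).

Definition accrued_variance (t : R) : R :=
  \int[leb]_(u in `[0, t]) (sigma u ^+ 2 / phi u ^+ 2).
Notation A := accrued_variance.

Lemma within_ratio_continuous (h : R -> R) (u : R) : horizon T u ->
  {within horizon T, continuous h} ->
  {within `[0, u]%classic, continuous (fun x => h x / phi x)}.
Proof.
move=> Tu ch; have phi_neq0 t : horizon T t -> phi t != 0.
  by move=> /phi_gt0; rewrite lt0r => /andP[].
apply: within_continuousM; first exact: continuous_subspaceW (segment_horizon Tu) ch.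
exact: continuous_subspaceW (segment_horizon Tu)
  (is_C1_on_continuous (is_C1_on_inv phi_neq0 phi_C1)).
Qed.

Lemma sqint_integrand (u : R) : horizon T u ->
  sqint leb (`[0, u]%classic : set R) (fun x => sigma x / phi x) = (A u)%:E.
Proof.
move=> Tu; have cf := within_ratio_continuous Tu sigma_cont.
have intf := segment_integrable (within_continuousM cf cf).
have e : (\int[leb]_(x in `[0%R, u]) (sigma x / phi x * (sigma x / phi x))%:E =
    sqint leb (`[0%R, u]%classic : set R) (fun x => (sigma x / phi x)%R))%E.
  by apply: eq_integral => x _; rewrite expr2.
have -> : A u = fine (sqint leb (`[0, u]%classic : set R) (fun x => sigma x / phi x)).
  by congr fine; apply: eq_integral => x _; rewrite exprMn exprVn.
rewrite fineK// -e; exact: integrable_fin_num intf.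
Qed.

Lemma accrued_variance_nondecreasing (s t : R) : 0 <= s -> s <= t -> horizon T t -> A s <= A t.
Proof.
move=> s0 st Tt; have Ts := horizon_le s0 st Tt.
rewrite -lee_fin -!sqint_integrand//; apply: ge0_subset_integral => //.
- apply/measurable_EFinP/measurable_funX; apply: segment_measurable_fun.
  exact: within_ratio_continuous.
- by move=> x _; rewrite lee_fin sqr_ge0.
- by move=> x /=; rewrite !in_itv/= => /andP[-> /le_trans->].
Qed.

Lemma accrued_variance0 : A 0 = 0.
Proof. by rewrite /A set_itv1 Rintegral_set1. Qed.

Lemma accrued_variance_ge0 t : 0 <= A t.
Proof.
by apply: Rintegral_ge0 => x _; rewrite mulr_ge0 ?invr_ge0 ?sqr_ge0.
Qed.

(** Enumerates the rational times t of the horizon with A t <= K; the other codes are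
    sent to 0, which is such a time. *)
Definition rational_time (K : R) (n : nat) : R :=
  let q := ratr (odflt 0 (unpickle n)) in
  if `[< horizon T q /\ A q <= K >] then q else 0.

Lemma rational_time_level (K : R) n : 0 <= K ->
  horizon T (rational_time K n) /\ A (rational_time K n) <= K.
Proof.
move=> K0; rewrite /rational_time; case: ifP => [/asboolP //|_].
by rewrite accrued_variance0; split => //; exact: horizon0.
Qed.

Lemma rational_timeE (K : R) (q : rat) : horizon T (ratr q) -> A (ratr q) <= K ->
  exists n, rational_time K n = ratr q.
Proof.
by move=> Tq Aq; exists (pickle q); rewrite /rational_time pickleK/=; case: asboolP => // -[].
Qed.

(** The latest of finitely many times bounds the others and still has variance at
    most K. *)
Lemma bounded_times (K : R) (s : nat -> R) (m : nat) : 0 <= K ->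
  (forall i, horizon T (s i) /\ A (s i) <= K) ->
  exists u, [/\ horizon T u, A u <= K & forall i, (i < m)%N -> s i <= u].
Proof.
move=> K0 hs; elim: m => [|m [u [Tu Au us]]].
  by exists 0; rewrite accrued_variance0; split => //; exact: horizon0.
have [sm|/ltW sm] := leP (s m) u.
  exists u; split => // i; rewrite ltnS leq_eqVlt => /predU1P[->//|]; exact: us.
have [Tm Am] := hs m; exists (s m); split => // i.
by rewrite ltnS leq_eqVlt => /predU1P[->//|/us/le_trans->].
Qed.

Definition tail_event (K r : R) : set Omega :=
  \bigcup_n [set w | 3 * r < `|M (rational_time K n) w|].

Lemma tail_event_measurable K r : 0 <= K -> measurable (tail_event K r).
Proof.
move=> K0; apply: bigcup_measurable => n _; apply: measurable_gt_normr.
apply: (normalized_solution_measurable Z_sol).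
by have [] := rational_time_level n K0.
Qed.

(** Finitely many times lie in a segment [0, u] with A u <= K, to which
    [wiener_integral_maximal] applies; continuity from below does the rest. *)
Lemma tail_event_bound (K r : R) : 0 <= K -> 0 < r ->
  (P (tail_event K r) <= (4 * c * K / r ^+ 2)%:E)%E.
Proof.
move=> K0 r0; pose E n := [set w | 3 * r < `|M (rational_time K n) w|].
have mE n : measurable (E n).
  apply: measurable_gt_normr; apply: (normalized_solution_measurable Z_sol).
  by have [] := rational_time_level n K0.
pose F n := \big[setU/set0]_(i < n) E i.
have mF n : measurable (F n) by exact: bigsetU_measurable.
have -> : tail_event K r = \bigcup_n F n.
  apply/seteqP; split => w [n _ hw].
    by exists n.+1 => //; rewrite /F -(bigcup_mkord _ E); exists n => //=.
  by move: hw; rewrite /F -(bigcup_mkord _ E) => -[i _ ?]; exists i.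
have cvgF : P (F n) @[n --> \oo] --> P (\bigcup_n F n).
  apply: nondecreasing_cvg_mu => //; first exact: bigcup_measurable.
  move=> m n mn; apply/subsetPset; rewrite /F -!(bigcup_mkord _ E).
  by move=> w [i /= im ?]; exists i => //=; exact: leq_trans mn.
rewrite -(cvg_lim _ cvgF)//; apply: lime_le; first by apply/cvg_ex; exists (P (\bigcup_n F n)).
apply: nearW => m.
have [u [Tu Au us]] := bounded_times m K0 (fun i => rational_time_level i K0).
pose s i := if (i < m)%N then rational_time K i else 0.
have -> : F m = \big[setU/set0]_(i < m) [set w | 3 * r < `|M (s i) w|].
  by apply: eq_bigr => i _; rewrite /s ltn_ord.
have u0 : 0 <= u by case: Tu.
apply: (wiener_integral_maximal B_wiener u0 (f := fun x => sigma x / phi x)) => //.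
- exact: within_ratio_continuous.
- move=> i; rewrite /s; case: ifPn => [im|]; last by rewrite lexx.
  rewrite us// andbT; by have [[]] := rational_time_level i K0.
- move=> x /andP[x0 xu].
  exact: (normalized_solution_wiener_integral T_gt0 phi_gt0 phi_C1 phi0
    psi_cont sigma_cont B_wiener Z_sol).
- by rewrite sqint_integrand// lee_fin.
Qed.

(** Rational times slightly before t have variance at most A t, so continuity of the
    path from the left suffices. *)
Lemma sup_bound_outside_tail (w : Omega) (K r : R) : 0 < r ->
  {within horizon T, continuous (fun t => Z t w)} ->
  ~ tail_event K r w ->
  forall t, horizon T t -> A t <= K -> `|M t w| <= 3 * r.
Proof.
move=> r0 cZ nE t Tt At.
have t0 : 0 <= t by case: Tt.
have subI := segment_horizon Tt.
have bound (q : rat) : horizon T (ratr q) -> A (ratr q) <= K -> `|M (ratr q) w| <= 3 * r.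
  move=> Tq Aq; have [n nq] := rational_timeE Tq Aq.
  rewrite leNgt; apply/negP => h; apply: nE; exists n => //=.
  by rewrite nq.
move: t0; rewrite le_eqVlt => /predU1P[t0|t0].
  by rewrite -t0 -[0](@raddf0 _ _ (@ratr R)) ; apply: bound; rewrite raddf0 t0.
have cM : {within `[0, t]%classic, continuous (fun s => `|M s w|)}.
  apply: within_continuous_norm; apply: within_continuousB; first apply: within_continuousB.
  - exact: within_ratio_continuous.
  - exact: within_continuous_cst.
  - apply: (@parameterized_integral_continuous _ 0 t (fun s => psi s / phi s)); first exact: ltW.
    exact/segment_integrable/within_ratio_continuous.
apply/ler_addgt0Pr => e e0.
have [dl dl0 hdl] := segment_uniform_continuity cM e0.
have [|q] := @rat_in_itvoo _ (Num.max 0 (t - dl)) t.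
  by rewrite gt_max t0 ltrBlDr ltrDl.
rewrite in_itv/= gt_max => /andP[/andP[q0 qdl] qt].
have Tq : horizon T (ratr q) by exact: horizon_le (ltW q0) (ltW qt) Tt.
have := hdl t (ratr q); rewrite !in_itv/= lexx (ltW t0) (ltW q0) (ltW qt).
rewrite ger0_norm ?subr_ge0 ?(ltW qt)// => /(_ isT isT) h.
have tq : t - ratr q <= dl by lra.
have Mq := bound q Tq (le_trans (accrued_variance_nondecreasing (ltW q0) (ltW qt) Tt) At).
have := le_trans (ler_norm _) (h tq); lra.
Qed.

End tail_bound.

(** * Almost sure growth and decay *)

Lemma borel_cantelli_geometric d (Omega : measurableType d) (R : realType)
    (P : probability Omega R) (F : nat -> set Omega) (C rho : R) :
  (forall n, measurable (F n)) -> 0 <= C -> 0 <= rho -> rho < 1 ->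
  (forall n, (P (F n) <= (C * rho ^+ n)%:E)%E) ->
  {ae P, forall w, exists n0, forall n, (n0 <= n)%N -> ~ F n w}.
Proof.
move=> mF C0 rho0 rho1 PF.
have sumF : (\sum_(0 <= n <oo) P (F n) < +oo)%E.
  apply: (@le_lt_trans _ _ (C / (1 - rho))%:E); last by rewrite ltry.
  apply: lime_le; first exact: is_cvg_nneseries.
  apply: nearW => n; apply: (@le_trans _ _ (\sum_(0 <= i < n) (C * rho ^+ i)%:E)%E).
    by apply: lee_sum => i _.
  rewrite sumEFin lee_fin -big_distrr/= ler_wpM2l//.
  have r1 : 0 < 1 - rho by rewrite subr_gt0.
  rewrite -[leRHS]mul1r ler_pdivlMr// mulrC big_mkord.
  have := subrX1 rho n; have := exprn_ge0 n rho0; nra.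
have mL : measurable (lim_sup_set F).
  by apply: bigcapT_measurable => n; apply: bigcup_measurable => j _; exact: mF.
exists (lim_sup_set F); split => //; first exact: lim_sup_set_cvg0.
move=> w /= nw n _; apply: contrapT => h; apply: nw; exists n => m nm Fm.
by apply: h; exists m.
Qed.

(** With X = L + 2 A and th = p / q one has phi X^p = phi^(1 - th) (phi X^q)^th.  The
    second factor is bounded because X^q <= (2 L)^q + (4 A)^q, and the first tends
    to 0 with phi. *)
Lemma power_envelope_decay (R : realType) (G : set_system R) (FG : Filter G)
    (phi A m : R -> R) (C L p q : R) :
  0 < p -> p < q -> 1 <= L -> 0 <= C ->
  (\forall t \near G, [/\ 0 < phi t, 0 <= A t, phi t * A t `^ q <= C &
     `|m t| <= 3 * (L + 2 * A t) `^ p]) ->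
  phi t @[t --> G] --> 0 ->
  phi t * m t @[t --> G] --> 0.
Proof.
move=> p0 pq L1 C0 hG phiG.
have q0 : 0 < q by exact: lt_trans pq.
pose C' := (2 * L) `^ q + 4 `^ q * C.
pose th := p / q.
have th0 : 0 < th by rewrite divr_gt0.
have th1 : 0 < 1 - th by rewrite subr_gt0 ltr_pdivrMr// mul1r.
have C'0 : 0 <= C' by rewrite addr_ge0 ?mulr_ge0 ?powR_ge0.
apply/cvgrPdist_le => e e0.
pose D := 3 * C' `^ th + 1.
have D0 : 0 < D by rewrite ltr_wpDl// mulr_ge0 ?powR_ge0.
pose eta := (e / D) `^ (1 - th)^-1.
have eta0 : 0 < eta by rewrite powR_gt0// divr_gt0.
near=> t.
have [phit At AC mt] : [/\ 0 < phi t, 0 <= A t, phi t * A t `^ q <= C &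
     `|m t| <= 3 * (L + 2 * A t) `^ p] by near: t.
have phi1 : phi t <= 1.
  have : `|0 - phi t| <= 1 by near: t; move/cvgrPdist_le : phiG; exact.
  by rewrite sub0r normrN ger0_norm// ltW.
have phieta : phi t <= eta.
  have : `|0 - phi t| <= eta by near: t; move/cvgrPdist_le : phiG; exact.
  by rewrite sub0r normrN ger0_norm// ltW.
rewrite sub0r normrN normrM ger0_norm ?(ltW phit)//.
set X := L + 2 * A t in mt *.
have X0 : 0 <= X by rewrite /X; lra.
have Xq : phi t * X `^ q <= C'.
  have XU : X `^ q <= (2 * L) `^ q + (4 * A t) `^ q.
    have [LA|AL] := leP L (2 * A t).
      rewrite (@le_trans _ _ ((4 * A t) `^ q)) ?lerDr ?powR_ge0//.
      by apply: ge0_ler_powR; rewrite ?nnegrE ?(ltW q0)// /X; lra.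
    rewrite (@le_trans _ _ ((2 * L) `^ q)) ?lerDl ?powR_ge0//.
    by apply: ge0_ler_powR; rewrite ?nnegrE ?(ltW q0)// /X; lra.
  apply: (le_trans (ler_wpM2l (ltW phit) XU)).
  rewrite mulrDr lerD//; first by rewrite ler_piMl ?powR_ge0.
  by rewrite powRM// mulrCA ler_wpM2l ?powR_ge0.
have -> : phi t = phi t `^ (1 - th) * phi t `^ th.
  by rewrite -powRD ?subrK ?powRr1 ?ltW// oner_eq0.
have Xp : X `^ p = (X `^ q) `^ th.
  by rewrite -powRrM /th mulrCA divff ?mulr1// gt_eqF.
apply: (@le_trans _ _ (phi t `^ (1 - th) * (3 * C' `^ th))).
  rewrite -mulrA ler_wpM2l ?powR_ge0//.
  apply: (le_trans (ler_wpM2l (powR_ge0 _ _) mt)).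
  rewrite mulrCA ler_wpM2l// Xp -powRM ?powR_ge0 ?(ltW phit)//.
  apply: ge0_ler_powR; rewrite ?nnegrE//; first exact: ltW.
  by rewrite mulr_ge0 ?powR_ge0// ltW.
have phith : phi t `^ (1 - th) <= e / D.
  have -> : e / D = eta `^ (1 - th).
    by rewrite -powRrM mulVf ?gt_eqF// powRr1// divr_ge0// ltW.
  by apply: ge0_ler_powR; rewrite ?nnegrE// ltW.
apply: (@le_trans _ _ (e / D * D)); last by rewrite divfK// gt_eqF.
by apply: ler_pM => //; rewrite ?powR_ge0 ?mulr_ge0 ?powR_ge0// /D lerDl.
Unshelve. all: by end_near. Qed.

Lemma left_nbhs_horizon (R : realType) (T : \bar R) : (0 < T)%E ->
  \forall t \near left_nbhs T, horizon T t.
Proof.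
case: T => [r| |] //=; rewrite ?lte_fin => r0.
  near=> t; split; first by apply/ltW; near: t; exact: nbhs_left_gt.
  by rewrite lte_fin; near: t; exact: nbhs_left_lt.
near=> t; split; last by rewrite ltry.
by near: t; exact: nbhs_pinfty_ge.
Unshelve. all: by end_near. Qed.

(** The least admissible n works: if it is larger than n0 then 2^(n - 1) < a. *)
Lemma dyadic_level (R : realType) (a : R) (n0 : nat) : 0 <= a ->
  exists n, [/\ (n0 <= n)%N, a <= 2 ^+ n & 2 ^+ n <= 2 ^+ n0 + 2 * a].
Proof.
move=> a0.
have : exists k, a <= 2 ^+ (n0 + k).
  exists (Num.bound a); apply: (@le_trans _ _ (Num.bound a)%:R).
    by apply/ltW; exact: archi_boundP.
  rewrite -natrX ler_nat (leq_trans (ltnW (ltn_expl _ (ltnSn 1))))//.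
  by rewrite leq_exp2l// leq_addl.
move=> /ex_minnP[k ak kmin]; exists (n0 + k)%N; split => //; first exact: leq_addr.
case: k => [|k] in ak kmin *; first by rewrite addn0 lerDl mulr_ge0.
have : 2 ^+ (n0 + k) < a by rewrite ltNge; apply/negP => /kmin; rewrite ltnn.
rewrite addnS exprS => h; have := exprn_ge0 n0 (ler0n R 2); lra.
Qed.

Theorem proposition2p4 (R : realType) (T : \bar R)
    (phi dphi psi sigma : R -> R)
    (d : measure_display) (Omega : measurableType d) (P : probability Omega R)
    (B : R -> {RV P >-> R}) (xi : R) (Z : R -> Omega -> R)
    (T_gt0 : (0 < T)%E)
    (phi_gt0 : forall t, horizon T t -> 0 < phi t)
    (phi_C1 : is_C1_on (horizon T) phi dphi)
    (phi0 : phi 0 = 1)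
    (psi_cont : {within horizon T, continuous psi})
    (sigma_cont : {within horizon T, continuous sigma})
    (sigma_neq0 : exists delta : \bar R,
      [/\ (0 < delta)%E, (delta <= T)%E &
          forall t : R, 0 < t -> (t%:E < delta)%E -> sigma t <> 0])
    (B_wiener : is_wiener B)
    (Z_sol : is_strong_solution B T (fun t => dphi t / phi t) psi sigma xi Z)
    (phi_lim : phi t @[t --> left_nbhs T] --> 0)
    (phi_bounded : exists2 eps : R, 0 < eps &
      [bounded phi t *
         (\int[lebesgue_measure]_(u in `[0, t]) (sigma u ^+ 2 / phi u ^+ 2))
           `^ (2^-1 + eps) | t in horizon T]) :
  {ae P, forall w,
    (Z t w - fine 'E_P[Z t]) @[t --> left_nbhs T] --> 0}.
Proof.
have [eps eps0 bnd] := phi_bounded.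
have phi_neq0 t : horizon T t -> phi t != 0.
  by move=> /phi_gt0; rewrite lt0r => /andP[].
set M := normalized_solution phi psi xi Z.
pose k t := \int[lebesgue_measure]_(s in `[0, t]) (psi s / phi s).
have ZM t w : horizon T t -> Z t w = phi t * M t w + phi t * (xi + k t).
  by move=> /phi_neq0 phit; rewrite /M /normalized_solution /k; field.
have EZ t : horizon T t -> fine 'E_P[Z t] = phi t * (xi + k t).
  move=> Tt; have t0 : 0 <= t by case: Tt.
  have pM := normalized_solution_wiener_integral T_gt0 phi_gt0 phi_C1 phi0
    psi_cont sigma_cont B_wiener Z_sol Tt t0 (lexx t).
  have fv : (sqint lebesgue_measure (`[0%R, t]%classic : set R)
      (fun x => (sigma x / phi x * \1_(`]0%R, t]%classic : set R) x)%R) <=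
      (accrued_variance phi sigma t)%:E)%E.
    rewrite -(sqint_integrand phi_gt0 phi_C1 sigma_cont Tt).
    have mf := segment_measurable_fun (within_ratio_continuous phi_gt0 phi_C1 Tt sigma_cont).
    apply: le_sqint => //.
      by apply: measurable_funM => //; exact: measurable_indic.
    by move=> x _; rewrite normrM ler_piMr// indicE; case: (_ \in _); rewrite ?normr1 ?normr0.
  have [intM M0] := wiener_integral_mean0 B_wiener pM fv.
  rewrite unlock.
  have -> : (\int[P]_w (Z t w)%:E =
      \int[P]_w ((phi t)%:E * (M t w)%:E + (phi t * (xi + k t))%:E))%E.
    by apply: eq_integral => w _; rewrite ZM.
  rewrite integralD//; last 2 first.
  - exact: integrableZl.
  - exact: finite_measure_integrable_cst.
  rewrite integralZl//= [X in (_ * X)%E]M0 mule0 add0e.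
  by rewrite integral_cst//= probability_setT mule1.
pose p := 2^-1 + eps / 2; pose q := 2^-1 + eps.
have p0 : 0 < p by rewrite /p; lra.
have pq : p < q by rewrite /p /q; lra.
pose r (n : nat) : R := (2 ^+ n) `^ p.
have pow2 n : 0 < 2 ^+ n :> R by rewrite exprn_gt0.
have r0 n : 0 < r n by rewrite powR_gt0.
pose F n := tail_event T phi psi sigma xi Z (2 ^+ n) (r n).
have K0 n : 0 <= 2 ^+ n :> R by exact: ltW.
have mF n : measurable (F n) by exact: (tail_event_measurable T_gt0 Z_sol (r n) (K0 n)).
pose rho : R := 2 `^ (- eps).
have rho1 : rho < 1.
  rewrite /rho powRN invf_lt1 ?powR_gt0//.
  have : 1 `^ eps < 2 `^ eps :> R by apply: gt0_ltr_powR; rewrite ?nnegrE//; lra.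
  by rewrite powR1.
have PF n : (P (F n) <= (4 * normal_second_moment R * rho ^+ n)%:E)%E.
  apply: le_trans (tail_event_bound T_gt0 phi_gt0 phi_C1 phi0 psi_cont sigma_cont
    B_wiener Z_sol (K0 n) (r0 n)) _.
  rewrite lee_fin -mulrA ler_wpM2l ?mulr_ge0 ?normal_second_moment_ge0//.
  (* r n ^ 2 = (2^n)^(2 p) and 2 p = 1 + eps. *)
  have -> : r n ^+ 2 = 2 ^+ n * (2 `^ eps) ^+ n.
    rewrite -[(2 `^ eps) ^+ n]powR_mulrn ?powR_ge0// powRAC powR_mulrn//.
    have n2 (x : R) : (x == 0) ==> (2 ^+ n != 0 :> R) by rewrite (gt_eqF (pow2 n)) implybT.
    rewrite /r expr2 -powRD//.
    have -> : p + p = 1 + eps by rewrite /p; lra.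
    by rewrite powRD// powRr1.
  by rewrite invfM mulrA divff ?gt_eqF// mul1r /rho powRN exprVn.
have BC := borel_cantelli_geometric mF
  (mulr_ge0 (ler0n R 4) (normal_second_moment_ge0 R)) (powR_ge0 2 (- eps)) rho1 PF.
apply: filterS2 BC (solution_cont Z_sol) => w [n0 Fw] cZ.
have [C C0 hC] : exists2 C : R, 0 < C & forall t, horizon T t ->
    phi t * accrued_variance phi sigma t `^ q <= C.
  have [C /= C0 hC] := pinfty_ex_gt0 bnd; exists C => // t Tt.
  by rewrite (le_trans (ler_norm _))// hC.
have envelope t : horizon T t ->
    `|M t w| <= 3 * (2 ^+ n0 + 2 * accrued_variance phi sigma t) `^ p.
  move=> Tt; have [n [n0n An nA]] := dyadic_level n0 (accrued_variance_ge0 phi sigma t).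
  apply: le_trans (sup_bound_outside_tail phi_gt0 phi_C1 psi_cont sigma_cont
    (r0 n) cZ (Fw n n0n) Tt An) _.
  rewrite ler_wpM2l// /r; apply: ge0_ler_powR; rewrite ?nnegrE ?(ltW p0)//.
  exact: le_trans nA.
have hT := left_nbhs_horizon T_gt0.
have lim0 : phi t * M t w @[t --> left_nbhs T] --> 0.
  apply: (@power_envelope_decay R (left_nbhs T) _ phi (accrued_variance phi sigma)
    (M^~ w) C (2 ^+ n0) p q p0 pq) => //; [|exact: ltW|].
    by rewrite exprn_ege1// ler1n.
  apply: filterS hT => t Tt; split;
    [exact: phi_gt0|exact: accrued_variance_ge0|exact: hC|exact: envelope].
apply: cvg_trans lim0; apply: near_eq_cvg; apply: filterS hT => t Tt.
by rewrite EZ// ZM// addrK.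
Qed.
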